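(* Let $c$ be a Coxeter element of $W$. Every $c$-cluster in $\Pi(c)$ (i.e. every maximal subset of $\Pi(c)$ consisting of pairwise $c$-compatible weights) is a $\mathbb{Z}$-basis of the weight lattice $P$.
   Context: Let $I$ be a finite type Dynkin diagram (identified with its vertex set, $|I|=n$), with crystallographic root system $\Phi$, simple roots $\{\alpha_i\}_{i\in I}$, fundamental weights $\{\omega_i\}_{i\in I}$, root lattice $Q$, weight lattice $P$, $P_\mathbb{R}=P\otimes\mathbb{R}$, Weyl group $W$ generated by simple reflections $s_i$, and longest element $w_0$. For $i\in I$ let $i^*\in I$ be defined by $\omega_{i^*}=-w_0\omega_i$. A Coxeter element $c\in W$ is a product of all simple reflections, each appearing exactly once. For $i\in I$, $h(i;c)$ denotes the minimal positive integer with $c^{h(i;c)}\omega_i=-\omega_{i^*}$. Put $\Pi(c):=\{c^m\omega_i: i\in I,\ 0\le m\le h(i;c)\}$. Define the bijection $\tau_c:\Pi(c)\to\Pi(c)$ by $\tau_c(-\omega_i)=\omega_i$ for $i\in I$ and $\tau_c(\lambda)=c\lambda$ otherwise. For $\gamma\in Q$, $[\gamma;\alpha_i]$ is the coefficient of $\alpha_i$ in $\gamma$ written in the basis of simple roots, and $[x]_+=\max\{x,0\}$. The $c$-compatibility degree $(\bullet||\bullet)_c$ is the unique function $\Pi(c)\times\Pi(c)\to\mathbb{Z}$ satisfying $(\tau_c\lambda||\tau_c\mu)_c=(\lambda||\mu)_c$ for all $\lambda,\mu$ and $(\omega_i||\lambda)_c=[(c^{-1}-1)\lambda;\alpha_i]_+$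 for all $i\in I$, $\lambda\in\Pi(c)$. Two weights $\lambda,\mu\in\Pi(c)$ are $c$-compatible if $(\lambda||\mu)_c=0$ (this relation is symmetric). *)

(* Defs.v *)
(* Weights are integer column vectors of coordinates in the
   basis of fundamental weights (omega_i), i.e. P = Z^n. *)
From mathcomp Require Import all_boot all_order all_algebra all_fingroup.
Set Implicit Arguments. Unset Strict Implicit. Unset Printing Implicit Defensive.
Import Order.TTheory GRing.Theory Num.Theory.
Local Open Scope ring_scope.

Section Defs.
Variable n : nat.
Implicit Types (A : 'M[int]_n).

(* Cartan matrix of finite type (crystallographic): a_ii = 2, a_ij <= 0 for
   i <> j, symmetrizable by a positive diagonal d with D A positive definite.
   Convention: A i j = <alpha_i^vee, alpha_j>. *)
Definition finite_type_cartan A : Prop :=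
  (forall i, A i i = 2) /\
  (forall i j, i != j -> A i j <= 0) /\
  exists d : 'I_n -> rat,
    (forall i, 0 < d i) /\
    (forall i j, d i * (A i j)%:~R = d j * (A j i)%:~R) /\
    (forall x : 'cV[rat]_n, x != 0 ->
       0 < (x^T *m (\matrix_(i, j) (d i * (A i j)%:~R)) *m x) 0 0).

(* fundamental weight omega_i and simple root alpha_j, in omega-coordinates *)
Definition omega (i : 'I_n) : 'cV[int]_n := \col_k ((k == i)%:R).
Definition alpha A (j : 'I_n) : 'cV[int]_n := \col_k (A k j).

(* simple reflection s_i : lambda |-> lambda - <alpha_i^vee, lambda> alpha_i *)
Definition sref A (i : 'I_n) : 'M[int]_n :=
  \matrix_(k, l) ((k == l)%:R - A k i * (i == l)%:R).

Definition wordmx A (s : seq 'I_n) : 'M[int]_n :=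
  foldr (fun i M => sref A i *m M) 1%:M s.

Definition inW A (w : 'M[int]_n) : Prop := exists s, wordmx A s = w.

Definition is_longest A (w0 : 'M[int]_n) : Prop :=
  exists L : nat,
    (exists s, size s = L /\ wordmx A s = w0) /\
    (forall s, wordmx A s = w0 -> (L <= size s)%N) /\
    (forall s, exists s', wordmx A s' = wordmx A s /\ (size s' <= L)%N).

Definition coxeter A (sigma : {perm 'I_n}) : 'M[int]_n :=
  wordmx A [seq sigma k | k <- enum 'I_n].

Definition mxpow (M : 'M[int]_n) (m : nat) : 'M[int]_n := iter m (mulmx M) 1%:M.

(* h = h(i;c): minimal positive integer with c^h omega_i = -omega_{i^*}
   = w0 omega_i *)
Definition is_h (c w0 : 'M[int]_n) (i : 'I_n) (h : nat) : Prop :=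
  (0 < h)%N /\ mxpow c h *m omega i = w0 *m omega i /\
  (forall k : nat, (0 < k)%N -> (k < h)%N -> mxpow c k *m omega i <> w0 *m omega i).

Definition inPi (c w0 : 'M[int]_n) (lam : 'cV[int]_n) : Prop :=
  exists (i : 'I_n) (m h : nat), is_h c w0 i h /\ (m <= h)%N /\
    lam = mxpow c m *m omega i.

Definition tau (c : 'M[int]_n) (lam : 'cV[int]_n) : 'cV[int]_n :=
  if [exists i, lam == - omega i] then - lam else c *m lam.

Definition is_compat_degree A (c w0 : 'M[int]_n)
    (f : 'cV[int]_n -> 'cV[int]_n -> int) : Prop :=
  (forall lam mu, inPi c w0 lam -> inPi c w0 mu ->
      f (tau c lam) (tau c mu) = f lam mu) /\
  (forall (i : 'I_n) lam (q : 'I_n -> int), inPi c w0 lam ->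
      invmx c *m lam - lam = \sum_(j < n) q j *: alpha A j ->
      f (omega i) lam = Num.max (q i) 0).

Definition compat_set (c w0 : 'M[int]_n) (f : 'cV[int]_n -> 'cV[int]_n -> int) (s : seq 'cV[int]_n) : Prop :=
  (forall lam, lam \in s -> inPi c w0 lam) /\
  (forall lam mu, lam \in s -> mu \in s -> lam != mu -> f lam mu = 0).

Definition is_cluster (c w0 : 'M[int]_n) (f : 'cV[int]_n -> 'cV[int]_n -> int) (s : seq 'cV[int]_n) : Prop :=
  uniq s /\ compat_set c w0 f s /\
  (forall t, compat_set c w0 f t -> {subset s <= t} -> {subset t <= s}).

Definition is_Zbasis (s : seq 'cV[int]_n) : Prop :=
  uniq s /\
  (forall v : 'cV[int]_n, exists a : 'I_(size s) -> int,
      v = \sum_(k < size s) a k *: s`_k) /\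
  (forall a : 'I_(size s) -> int,
      \sum_(k < size s) a k *: s`_k = 0 -> forall k, a k = 0).

End Defs.

(* Main.v *)
(* Order the vertices as in the Coxeter word and let E be the Euler form on the root lattice:
   E(a_i, a_i) = d_i, E(a_i, a_j) = d_i A_ij if i precedes j, and 0 otherwise, so that E + E^T
   is the invariant form and E(z, c y) = - E(y, z).  Let P_i be the basis of the root lattice
   with E(P_i, z) = d_i z_i.  The map c^-1 - 1 identifies Pi(c) with the "almost positive roots"
   {positive roots} + {- P_i}, omega_i going to - P_i, and under this identification two
   positive roots x, y are compatible iff E(x, y) >= 0 and E(y, x) >= 0, while - P_i is compatible
   with x iff x_i = 0 and with every - P_j: this relation is invariant under tau_c, and each
   tau_c-orbit meets the - P_i, where it agrees with the degree by definition.

   Since E restricts to parabolic subsystems, this gives an induction on the rank: a cluster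
   containing - P_i is - P_i plus a cluster of the parabolic without i, and powers of tau_c move
   any cluster to one containing some - P_i.  The property carried along is that the positive
   roots of the cluster generate the root lattice of the parabolic obtained by deleting all
   i with - P_i in the cluster. *)
Require Import Defs.
From mathcomp Require Import all_boot all_order all_algebra all_fingroup.
From mathcomp Require Import zify ring.
Set Implicit Arguments. Unset Strict Implicit. Unset Printing Implicit Defensive.
Import Order.TTheory GRing.Theory Num.Theory.
Local Open Scope ring_scope.

(** * The Euler form attached to a Coxeter word *)

Section EulerForm.

Variables (n : nat) (A : 'M[int]_n) (d : 'I_n -> int) (pos : 'I_n -> nat).
Hypothesis A_diag : forall i, A i i = 2.
Hypothesis A_offdiag : forall i j, i != j -> A i j <= 0.
Hypothesis d_gt0 : forall i, 0 < d i.
Hypothesis dA_sym : forall i j, d i * A i j = d j * A j i.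
Hypothesis pos_inj : injective pos.

Implicit Types (x y z : 'cV[int]_n) (i j k : 'I_n) (l : seq 'I_n).

(* [d] is the symmetrizer of the Cartan matrix, scaled to be integral; [pos i] is the position
   of the reflection [i] in the Coxeter word. *)
Definition eulermx : 'M[int]_n :=
  \matrix_(i, j) if i == j then d i else if (pos i < pos j)%N then d i * A i j else 0.

Definition euler x y : int := (x^T *m eulermx *m y) 0 0.

Lemma eulermx_sym i j : eulermx i j + eulermx j i = d i * A i j.
Proof.
rewrite !mxE (eq_sym j); case: eqVneq => [->|nij]; first by rewrite A_diag; ring.
have : pos i != pos j by apply: contra_neq nij => /pos_inj.
by rewrite neq_ltn; case: ltngtP => // _ _; rewrite ?addr0 ?add0r.
Qed.

Lemma eulermx_offdiag i j : i != j -> eulermx i j <= 0.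
Proof.
move=> nij; rewrite mxE (negbTE nij); case: ifP => // _.
by rewrite pmulr_rle0 // A_offdiag.
Qed.

Lemma eulermx_dvdl i j : (d i %| eulermx i j)%Z.
Proof. by rewrite mxE; case: ifP => // _; case: ifP => // _; rewrite dvdz_mulr. Qed.

Lemma euler_suml x y : euler x y = \sum_j x j 0 * (eulermx *m y) j 0.
Proof. by rewrite /euler -mulmxA mxE; apply: eq_bigr => j _; rewrite mxE. Qed.

Lemma euler_sumr x y : euler x y = \sum_j (eulermx^T *m x) j 0 * y j 0.
Proof.
rewrite /euler mxE; apply: eq_bigr => j _; congr (_ * _).
by rewrite -[in RHS](trmxK x) -trmx_mul [in RHS]mxE.
Qed.

Lemma eulerDl x y z : euler (x + y) z = euler x z + euler y z.
Proof. by rewrite /euler linearD !mulmxDl mxE. Qed.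
Lemma eulerDr x y z : euler x (y + z) = euler x y + euler x z.
Proof. by rewrite /euler mulmxDr mxE. Qed.
Lemma eulerNl x y : euler (- x) y = - euler x y.
Proof. by rewrite /euler linearN !mulNmx mxE. Qed.
Lemma eulerNr x y : euler x (- y) = - euler x y.
Proof. by rewrite /euler mulmxN mxE. Qed.
Lemma eulerBl x y z : euler (x - y) z = euler x z - euler y z.
Proof. by rewrite eulerDl eulerNl. Qed.
Lemma eulerBr x y z : euler x (y - z) = euler x y - euler x z.
Proof. by rewrite eulerDr eulerNr. Qed.
Lemma eulerZl a x y : euler (a *: x) y = a * euler x y.
Proof. by rewrite /euler linearZ /= -!scalemxAl mxE. Qed.
Lemma eulerZr a x y : euler x (a *: y) = a * euler x y.
Proof. by rewrite /euler -scalemxAr mxE. Qed.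

Definition basisv i : 'cV[int]_n := delta_mx i 0.

Lemma basisvE i j : basisv i j 0 = (j == i)%:R.
Proof. by rewrite mxE eqxx andbT. Qed.

Lemma scale_coord a x j : (a *: x) j 0 = a * x j 0.
Proof. by rewrite mxE. Qed.

Lemma sub_coord x y j : (x - y) j 0 = x j 0 - y j 0.
Proof. by rewrite !mxE. Qed.

Lemma opp_coord x j : (- x) j 0 = - x j 0.
Proof. by rewrite mxE. Qed.

Lemma cV_sum_basisv x : x = \sum_j x j 0 *: basisv j.
Proof.
apply/colP => k; rewrite summxE (bigD1 k) //= !mxE !eqxx mulr1 big1 ?addr0 // => j njk.
by rewrite !mxE eq_sym (negbTE njk) mulr0.
Qed.

Lemma euler_basisl j y : euler (basisv j) y = (eulermx *m y) j 0.
Proof.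
rewrite euler_suml (bigD1 j) //= big1 ?addr0 ?basisvE ?eqxx ?mul1r // => k nkj.
by rewrite basisvE (negbTE nkj) mul0r.
Qed.

Lemma euler_basisr j y : euler y (basisv j) = (eulermx^T *m y) j 0.
Proof.
rewrite euler_sumr (bigD1 j) //= big1 ?addr0 ?basisvE ?eqxx ?mulr1 // => k nkj.
by rewrite basisvE (negbTE nkj) mulr0.
Qed.

Lemma euler_basis_sym i x : euler (basisv i) x + euler x (basisv i) = d i * (A *m x) i 0.
Proof.
rewrite euler_basisl euler_basisr !mxE -big_split mulr_sumr /=.
by apply: eq_bigr => k _; rewrite [_^T _ _]mxE -mulrDl eulermx_sym mulrA.
Qed.

Lemma euler_basis i : euler (basisv i) (basisv i) = d i.
Proof. by rewrite euler_basisl -colE !mxE eqxx. Qed.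

Lemma euler_sum_sym x y :
  euler x y + euler y x = \sum_i x i 0 * d i * (A *m y) i 0.
Proof.
rewrite euler_suml euler_sumr -big_split; apply: eq_bigr => i _ /=.
by rewrite -mulrA -euler_basis_sym euler_basisl euler_basisr mulrDr; congr (_ + _); rewrite mulrC.
Qed.

Hypothesis euler_gt0 : forall x, x != 0 -> 0 < euler x x.

Lemma euler_eq0 x : euler x x = 0 -> x = 0.
Proof. by move=> h; apply/eqP; apply: contraT => /euler_gt0; rewrite h. Qed.

Lemma cartan_inj x : A *m x = 0 -> x = 0.
Proof.
move=> h; apply: euler_eq0; have := euler_sum_sym x x; rewrite h big1.
  by move=> /eqP; rewrite -mulr2n mulrn_eq0 => /eqP.
by move=> i _; rewrite mxE mulr0.
Qed.

(** * Roots and their signs *)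

Definition nonneg x := [forall i, 0 <= x i 0].

Lemma nonnegP x : reflect (forall i, 0 <= x i 0) (nonneg x).
Proof. exact: forallP. Qed.

(* With [x = \sum_j x_j alpha_j] and [euler x x] half its squared length, the divisibility says
   that the coroot of [x] is an integral combination of simple coroots. *)
Definition is_root x := (0 < euler x x) /\ forall j, (euler x x %| d j * x j 0%R)%Z.
Definition is_posroot x := is_root x /\ nonneg x.

Lemma is_rootN x : is_root x -> is_root (- x).
Proof.
rewrite /is_root eulerNl eulerNr opprK => -[h1 h2]; split=> // j.
by rewrite mxE mulrN dvdzE abszN -dvdzE.
Qed.

Lemma is_root_basis i : is_root (basisv i).
Proof.
split=> [|j]; rewrite euler_basis // basisvE; case: eqP => [->|_]; rewrite ?mulr1 //.
by rewrite mulr0 dvdz0.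
Qed.

Lemma nonneg_basis i : nonneg (basisv i).
Proof. by apply/nonnegP => j; rewrite basisvE. Qed.

Lemma posroot_basis i : is_posroot (basisv i).
Proof. by split; [exact: is_root_basis | exact: nonneg_basis]. Qed.

(* If [x = p - m] has mixed signs then [euler p m <= 0], while [euler x x] divides
   [euler p p] and [euler m m]: hence [euler x x >= 2 * euler x x]. *)
Lemma root_sign x : is_root x -> nonneg x \/ nonneg (- x).
Proof.
move=> [e_gt0 e_dvd]; set e := euler x x in e_gt0 e_dvd.
pose p : 'cV[int]_n := \col_i Num.max (x i 0) 0.
pose m : 'cV[int]_n := \col_i Num.max (- x i 0) 0.
have xE : x = p - m.
  by apply/colP => i; rewrite !mxE; case: (lerP 0 (x i 0)) => h; lia.
have mixed y z : (forall i, 0 <= y i 0) -> (forall i, 0 <= z i 0) ->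
    (forall i, y i 0 * z i 0 = 0) -> euler y z <= 0.
  move=> y0 z0 yz; rewrite euler_suml; apply: sumr_le0 => i _.
  rewrite mxE mulr_sumr; apply: sumr_le0 => j _.
  have [<-|nij] := eqVneq i j; first by rewrite mulrCA yz mulr0.
  by rewrite mulrCA mulr_le0_ge0 ?eulermx_offdiag // mulr_ge0.
have p0 i : 0 <= p i 0 by rewrite mxE le_max lexx orbT.
have m0 i : 0 <= m i 0 by rewrite mxE le_max lexx orbT.
have pm i : p i 0 * m i 0 = 0.
  by rewrite !mxE; case: (lerP 0 (x i 0)) => h; case: (lerP 0 (- x i 0)) => h'; nia.
have dvd y : (forall i, (y i 0 == 0) || (y i 0 == x i 0) || (y i 0 == - x i 0)) ->
    (e %| euler y y)%Z.
  move=> hy; rewrite euler_suml; apply: rpred_sum => i _.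
  rewrite mxE mulr_sumr; apply: rpred_sum => j _.
  have /dvdzP[t ->] := eulermx_dvdl i j.
  rewrite mulrA dvdz_mulr // (mulrC t) mulrA dvdz_mulr // mulrC.
  case/orP: (hy i) => [/orP[]|] /eqP ->; rewrite ?mulr0 ?dvdz0 //.
  by rewrite mulrN dvdzE abszN -dvdzE.
have ep : (e %| euler p p)%Z.
  by apply: dvd => i; rewrite mxE; case: (lerP 0 (x i 0)) => h; rewrite eqxx ?orbT.
have em : (e %| euler m m)%Z.
  apply: dvd => i; rewrite mxE; case: (lerP 0 (- x i 0)) => h; rewrite eqxx ?orbT //.
have ge y : y != 0 -> (e %| euler y y)%Z -> e <= euler y y.
  move=> /euler_gt0 y0 /dvdzP[t tE]; rewrite tE in y0 *.
  have t0 : 0 < t by rewrite -(pmulr_lgt0 _ e_gt0).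
  by rewrite ler_peMl // ltW.
have eE : e = euler p p + euler m m - (euler p m + euler m p).
  by rewrite /e xE !eulerBl !eulerBr; lia.
have pm_le : euler p m <= 0 by exact: mixed.
have mp_le : euler m p <= 0 by apply: mixed => // i; rewrite mulrC.
have [pz|/ge/(_ ep) gep] := eqVneq p 0.
  by right; apply/nonnegP => i; rewrite xE pz sub0r opprK.
have [mz|/ge/(_ em) gem] := eqVneq m 0.
  by left; apply/nonnegP => i; rewrite xE mz subr0.
by exfalso; lia.
Qed.

Lemma posrootP x i : is_root x -> 0 < x i 0 -> is_posroot x.
Proof.
move=> xr xi; split=> //; case: (root_sign xr) => // /nonnegP/(_ i).
by rewrite mxE oppr_ge0 leNgt xi.
Qed.

Lemma negrootP x : is_root x -> ~~ nonneg x -> is_posroot (- x).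
Proof. by move=> xr nx; split; [exact: is_rootN | case: (root_sign xr) => //; rewrite (negbTE nx)]. Qed.

Lemma root_neq0 x : is_root x -> x != 0.
Proof. by move=> [h _]; apply: contraTneq h => ->; rewrite /euler mulmx0 mxE. Qed.

Lemma posroot_exists x : is_posroot x -> exists i, 0 < x i 0.
Proof.
move=> [/root_neq0 x0 /nonnegP xp]; apply/existsP; apply: contraT => /existsPn h.
case/eqP: x0; apply/colP => i; rewrite mxE; apply/eqP.
by rewrite eq_le xp andbT leNgt h.
Qed.

Lemma posrootN x : is_posroot x -> ~~ nonneg (- x).
Proof.
move=> /posroot_exists[i xi]; apply/forallPn; exists i.
by rewrite mxE oppr_ge0 -ltNge.
Qed.

(** * Reflections and words on the root lattice *)

Definition rref i : 'M[int]_n := 1%:M - delta_mx i i *m A.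

Lemma rrefE i x : rref i *m x = x - (A *m x) i 0 *: basisv i.
Proof.
rewrite mulmxBl mul1mx -mulmxA; congr (_ - _); apply/colP => k.
rewrite mxE (bigD1 i) //= big1 ?addr0 => [|j nj]; first by rewrite !mxE eqxx !andbT mulrC.
by rewrite mxE (negbTE nj) andbF mul0r.
Qed.

(** A reflection preserves the symmetrized form, whose value at [x] is twice [euler x x]; [euler]
    itself need not be invariant. *)
Lemma euler_rref i x : euler (rref i *m x) (rref i *m x) = euler x x.
Proof.
rewrite rrefE !eulerBl !eulerBr !eulerZl !eulerZr euler_basis.
have := euler_basis_sym i x; set t := (A *m x) i 0 => h.
rewrite (_ : euler x (basisv i) = d i * t - euler (basisv i) x); last by rewrite -h; ring.
by ring.
Qed.

(** Only coordinate [i] moves, by [(A *m x) i 0]; times [d i] this is the sum of the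
    [d k * A k i * x k 0], and [euler x x] divides each [d k * x k 0]. *)
Lemma rref_root i x : is_root x -> is_root (rref i *m x).
Proof.
move=> [x0 xd]; rewrite /is_root euler_rref; split=> // j.
rewrite rrefE !mxE eqxx andbT mulrBr rpredB //.
case: eqP => [->|_]; last by rewrite mulr0 mulr0 dvdz0.
rewrite mulr1 mulr_sumr; apply: rpred_sum => k _.
by rewrite mulrA dA_sym mulrAC dvdz_mulr.
Qed.

Lemma rref_coord i j x : j != i -> (rref i *m x) j 0 = x j 0.
Proof. by move=> nji; rewrite rrefE !mxE (negbTE nji) mulr0 subr0. Qed.

Lemma rref_coord_diag i x : (rref i *m x) i 0 = x i 0 - (A *m x) i 0.
Proof. by rewrite rrefE [LHS]mxE; congr (_ + _); rewrite 2!mxE basisvE eqxx mulr1. Qed.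

Lemma rref_basis i : rref i *m basisv i = - basisv i.
Proof.
rewrite rrefE -colE mxE A_diag; apply/colP => k; rewrite !mxE; ring.
Qed.

(** A positive coordinate other than [i] survives and decides the sign. Without one,
    [x = a *: basisv i], and [d i * a ^ 2] dividing [d i * a] forces [a = 1]. *)
Lemma rref_pos i x : is_posroot x -> x <> basisv i -> is_posroot (rref i *m x).
Proof.
move=> [xr /nonnegP xp] nx; have yr := rref_root i xr.
have [/existsP[j /andP[nji xj]]|/existsPn h] :=
    boolP [exists j, (j != i) && (x j 0 != 0)].
  by apply: (posrootP (i := j)) => //; rewrite rref_coord // lt_def xj xp.
exfalso; apply: nx.
have xE : x = x i 0 *: basisv i.
  apply/colP => j; rewrite !mxE eqxx andbT; have := h j.
  by case: eqVneq => [->|_]; rewrite ?mulr1 ?mulr0 //= negbK => /eqP.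
have := xr; rewrite xE /is_root eulerZl eulerZr euler_basis => -[e0 /(_ i)].
rewrite !mxE !eqxx mulr1 => /dvdzP[t tE].
have := xp i; set a := x i 0 in e0 tE *; move=> a0.
have di := d_gt0 i.
suff -> : a = 1 by rewrite scale1r.
have /mulfI : d i != 0 by rewrite gt_eqF.
have {}tE : d i * a = d i * (t * a * a) by rewrite tE; ring.
move=> /(_ _ _ tE) tE1; clear -a0 tE1 e0 di.
have a1 : a != 0 by apply: contraTneq e0 => ->; rewrite mul0r.
have ta : 1 = t * a by apply: (mulIf a1); rewrite mul1r.
have {}a1 : 0 < a by rewrite lt_def a1 a0.
by clear -a1 ta; case: (lerP t 0) => ht; nia.
Qed.

Definition rword l : 'M[int]_n := foldr (fun i B => rref i *m B) 1%:M l.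

Lemma rword_cat l1 l2 : rword (l1 ++ l2) = rword l1 *m rword l2.
Proof. by elim: l1 => [|i l1 ih] /=; rewrite ?mul1mx // ih mulmxA. Qed.

Lemma rword_cons i l : rword (i :: l) = rref i *m rword l. Proof. by []. Qed.

Lemma rrefK i : rref i *m rref i = 1%:M.
Proof.
rewrite /rref mulmxBl mul1mx mulmxBr mulmx1.
suff -> : delta_mx i i *m A *m (delta_mx i i *m A) = (delta_mx i i *m A) *+ 2.
  by rewrite mulr2n opprB addrK subrK.
rewrite -[RHS]scaler_nat scalemxAl mulmxA; congr (_ *m _); apply/matrixP => a b.
rewrite !mxE (bigD1 i) //= big1 ?addr0 => [|j nj]; last first.
  by rewrite [delta_mx _ _ _ _]mxE (negbTE nj) mulr0.
rewrite !mxE (bigD1 i) //= big1 ?addr0 => [|j nj]; last by rewrite !mxE (negbTE nj) andbF mul0r.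
by rewrite !mxE !eqxx A_diag /= andbT; case: (a == i); case: (b == i).
Qed.

Lemma rwordVl l : rword (rev l) *m rword l = 1%:M.
Proof.
elim: l => [|i l ih]; first by rewrite mul1mx.
by rewrite rev_cons -cats1 rword_cat /= mulmx1 -mulmxA (mulmxA (rref i)) rrefK mul1mx.
Qed.

Lemma rwordVr l : rword l *m rword (rev l) = 1%:M.
Proof. by rewrite -{1}(revK l) rwordVl. Qed.

Lemma rwordK l x : rword (rev l) *m (rword l *m x) = x.
Proof. by rewrite mulmxA rwordVl mul1mx. Qed.

Lemma rwordVK l x : rword l *m (rword (rev l) *m x) = x.
Proof. by rewrite mulmxA rwordVr mul1mx. Qed.

Lemma rword_root l x : is_root x -> is_root (rword l *m x).
Proof.
move=> xr; elim: l => [|i l ih]; first by rewrite mul1mx.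
by rewrite rword_cons -mulmxA; apply: rref_root.
Qed.

Lemma rword_coord l j x : j \notin l -> (rword l *m x) j 0 = x j 0.
Proof.
elim: l => [|i l ih]; first by rewrite mul1mx.
rewrite inE negb_or => /andP[nji jl].
by rewrite rword_cons -mulmxA rref_coord // ih.
Qed.

(** Letters act from the right end of [l], and by [rref_pos] a letter [i] can destroy positivity
    only at [basisv i]. *)
Lemma rword_neg l x : is_posroot x -> ~~ nonneg (rword l *m x) ->
  exists l1 i l2, l = l1 ++ i :: l2 /\ rword l2 *m x = basisv i.
Proof.
move=> xp; elim: l => [|i l ih]; first by rewrite mul1mx; case: xp => _ ->.
have [lp|/ih[l1 [j [l2 [-> h]]]] _] := boolP (nonneg (rword l *m x)); last by exists (i :: l1), j, l2.
have [h|/eqP h] := eqVneq (rword l *m x) (basisv i); first by exists [::], i, l.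
rewrite rword_cons -mulmxA.
have [] : is_posroot (rref i *m (rword l *m x)).
  by apply: rref_pos => //; split=> //; apply: rword_root; case: xp.
by move=> _ ->.
Qed.


(** * Coxeter elements of parabolic subsystems *)

Definition supported l x := forall j, j \notin l -> x j 0 = 0.
Definition ordered l := pairwise (fun i j => pos i < pos j)%N l.

Lemma ordered_splitP l1 j l2 : ordered (l1 ++ j :: l2) ->
  [/\ forall k, k \in l1 -> (pos k < pos j)%N,
      forall k, k \in l2 -> (pos j < pos k)%N &
      forall a b, a \in l1 -> b \in l2 -> (pos a < pos b)%N].
Proof.
rewrite /ordered pairwise_cat /= => /and3P[/allrelP h1 _ /andP[/allP h2 _]].
by split=> [k kl|k /h2 //|a b al bl]; apply: h1 => //; rewrite inE ?eqxx // bl orbT.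
Qed.

Lemma ordered_uniq l : ordered l -> uniq l.
Proof. by apply: pairwise_uniq => i; rewrite ltnn. Qed.

Lemma supportedD l x y : supported l x -> supported l y -> supported l (x + y).
Proof. by move=> hx hy j jl; rewrite mxE hx // hy. Qed.
Lemma supportedN l x : supported l x -> supported l (- x).
Proof. by move=> hx j jl; rewrite mxE hx // oppr0. Qed.
Lemma supported_basis l i : i \in l -> supported l (basisv i).
Proof. by move=> il j jl; rewrite basisvE; case: eqP jl => // ->; rewrite il. Qed.
Lemma supported_rword l l' x : {subset l' <= l} -> supported l x -> supported l (rword l' *m x).
Proof. by move=> s hx j jl; rewrite rword_coord ?hx //; apply: contra jl; apply: s. Qed.

Lemma euler_cox l y z : ordered l -> supported l y -> supported l z ->
  euler z (rword l *m y) = - euler y z.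
Proof.
move=> ol ly lz; rewrite euler_suml euler_sumr -sumrN; apply: eq_bigr => j _.
have [jl|/lz ->] := boolP (j \in l); last by rewrite mulr0 mul0r oppr0.
rewrite mulrC -mulNr; congr (_ * _); apply/eqP; rewrite -addr_eq0; apply/eqP.
have ul := ordered_uniq ol.
case/splitPr: l / jl ol ly lz ul => l1 l2 ol ly _ ul.
set y2 := rword l2 *m y; set y' := rword _ *m y.
have [lt1 lt2 _] := ordered_splitP ol.
have [jl1 jl2] : j \notin l1 /\ j \notin l2.
  by move: ul; rewrite cat_uniq /= negb_or => /and3P[_ /andP[-> _] /andP[-> _]].
have y'E : y' = rword l1 *m (rref j *m y2) by rewrite /y' rword_cat rword_cons !mulmxA.
have y2E k : k \notin l2 -> y2 k 0 = y k 0 by exact: rword_coord.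
have y'j : y' j 0 = y j 0 - (A *m y2) j 0.
  by rewrite y'E rword_coord // rref_coord_diag y2E.
have y'k k : k != j -> k \notin l1 -> y' k 0 = y2 k 0.
  by move=> nk kl; rewrite y'E rword_coord // rref_coord.
(* [y2] is the vector on which [rref j] acts. A letter [k] with [eulermx j k] nonzero comes after
   [j], so [y'] agrees with [y2] there; one with [eulermx k j] nonzero comes before [j], so [y]
   agrees with [y2] there. Both row sums together give [d j * (A *m y2) j 0] minus itself. *)
have term k : eulermx j k * y' k 0 + eulermx k j * y k 0 =
    d j * (A j k * y2 k 0) - (if k == j then d j * (A *m y2) j 0 else 0).
  have [->|nkj] := eqVneq k j.
    by rewrite y'j y2E // [eulermx _ _]mxE eqxx A_diag; ring.
  rewrite subr0 [eulermx j k]mxE [eulermx k j]mxE (negbTE nkj) eq_sym (negbTE nkj).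
  have [kl2|kl2] := boolP (k \in l2).
    have jk := lt2 _ kl2; rewrite jk ltnNge ltnW //= y'k ?mul0r ?addr0 ?mulrA //.
    by apply/negP => /lt1; rewrite ltnNge ltnW // lt2.
  have [kl1|kl1] := boolP (k \in l1).
    have kj := lt1 _ kl1; rewrite kj ltnNge ltnW //= mul0r add0r y2E //.
    by rewrite dA_sym mulrA.
  rewrite y'k // y2E // ly ?mulr0 ?addr0 //.
  by rewrite mem_cat inE !negb_or kl1 kl2 nkj.
rewrite [X in X + _]mxE [X in _ + X]mxE -big_split /=; under eq_bigr => k _ do rewrite [eulermx^T _ _]mxE term.
by rewrite sumrB -mulr_sumr -big_mkcond big_pred1_eq mxE subrr.
Qed.

Lemma euler_cox_isom l y z : ordered l -> supported l y -> supported l z ->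
  euler (rword l *m z) (rword l *m y) = euler z y.
Proof.
move=> ol ly lz; rewrite euler_cox // ?euler_cox ?opprK //.
exact: supported_rword.
Qed.

(* In the language of quiver representations, [projroot l i] and [injroot l i] are the dimension
   vectors of the indecomposable projective and injective at [i]. *)
Definition injroot l i : 'cV[int]_n := rword (take (index i l) l) *m basisv i.
Definition projroot l i : 'cV[int]_n := rword (rev (drop (index i l).+1 l)) *m basisv i.

Lemma take_index_cat l1 i l2 : i \notin l1 -> take (index i (l1 ++ i :: l2)) (l1 ++ i :: l2) = l1.
Proof. by move=> il; rewrite index_cat (negbTE il) /= eqxx addn0 take_size_cat. Qed.

Lemma drop_index_cat l1 i l2 : i \notin l1 -> drop (index i (l1 ++ i :: l2)).+1 (l1 ++ i :: l2) = l2.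
Proof.
move=> il; rewrite index_cat (negbTE il) /= eqxx addn0 -cat_rcons drop_size_cat //.
by rewrite size_rcons.
Qed.

Lemma split_uniq l i : uniq l -> i \in l -> exists l1 l2,
  [/\ l = l1 ++ i :: l2, i \notin l1, i \notin l2,
      injroot l i = rword l1 *m basisv i & projroot l i = rword (rev l2) *m basisv i].
Proof.
move=> ul il; case/splitPr: l / il ul => l1 l2; exists l1, l2.
have [il1 il2] : i \notin l1 /\ i \notin l2.
  by move: ul; rewrite cat_uniq /= negb_or => /and3P[_ /andP[-> _] /andP[-> _]].
by split=> //; rewrite /injroot /projroot ?take_index_cat ?drop_index_cat.
Qed.

Lemma posroot_rword l i : i \notin l -> is_posroot (rword l *m basisv i).
Proof.
move=> il; apply: (posrootP (i := i)); first exact/rword_root/is_root_basis.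
by rewrite rword_coord // basisvE eqxx.
Qed.

Lemma inj_posroot l i : uniq l -> i \in l -> is_posroot (injroot l i).
Proof. by move=> ul /(split_uniq ul)[l1 [l2 [_ h _ -> _]]]; apply: posroot_rword. Qed.

Lemma proj_posroot l i : uniq l -> i \in l -> is_posroot (projroot l i).
Proof.
by move=> ul /(split_uniq ul)[l1 [l2 [_ _ h _ ->]]]; apply: posroot_rword; rewrite mem_rev.
Qed.

Lemma inj_supported l i : i \in l -> supported l (injroot l i).
Proof.
by move=> il; apply: supported_rword; [exact: mem_take | exact: supported_basis].
Qed.

Lemma proj_supported l i : i \in l -> supported l (projroot l i).
Proof.
move=> il; apply: supported_rword; last exact: supported_basis.
by move=> j; rewrite mem_rev => /mem_drop.
Qed.

Lemma cox_proj l i : uniq l -> i \in l -> rword l *m projroot l i = - injroot l i.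
Proof.
move=> ul /(split_uniq ul)[l1 [l2 [-> _ _ -> ->]]].
by rewrite rword_cat rword_cons -!mulmxA rwordVK rref_basis mulmxN.
Qed.

(** [injroot l i] involves only letters up to [i], and later coordinates of [z] do not pair with
    these, so [z] may be truncated to [z1]. The Coxeter element of the prefix [l1 ++ [:: i]] sends
    [basisv i] to [- injroot l i], and [euler_cox] leaves row [i] of the form. *)
Lemma euler_inj l i z : ordered l -> i \in l -> supported l z ->
  euler z (injroot l i) = d i * z i 0.
Proof.
move=> ol il lz; have ul := ordered_uniq ol.
have [l1 [l2 [lE il1 il2 iE _]]] := split_uniq ul il.
have ol' : ordered (l1 ++ [:: i]).
  by move: ol; rewrite lE /ordered -cat_rcons cats1 pairwise_cat => /and3P[].
rewrite lE in ol lz; have [lt1 lt2 lt12] := ordered_splitP ol.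
pose z1 : 'cV[int]_n := \col_j (if j \in l2 then 0 else z j 0).
have [z1s zi] : supported (l1 ++ [:: i]) z1 /\ z1 i 0 = z i 0.
  split=> [j|]; rewrite !mxE ?(negbTE il2) //; case: ifP => // jl2 jl.
  by apply: lz; move: jl; rewrite !mem_cat !inE jl2 orbF.
have -> : euler z (injroot l i) = euler z1 (injroot l i).
  rewrite !euler_suml; apply: eq_bigr => j _; rewrite [z1 j 0]mxE; case: ifP => // jl2.
  rewrite mul0r mxE big1 ?mulr0 // => k _; rewrite mxE.
  have [ejk|_] := eqVneq j k.
    rewrite -ejk iE rword_coord ?basisvE.
      by case: eqP il2 => [<-|_]; rewrite ?jl2 // mulr0.
    by apply: contraL jl2 => /lt1 /ltnW; rewrite leqNgt; apply: contra => /lt2.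
  case: ifP => [jk|]; last by rewrite mul0r.
  rewrite iE rword_coord ?basisvE; last first.
    by apply/negP => /lt12/(_ jl2); rewrite ltnNge ltnW.
  by case: eqP jk => [->|_]; rewrite ?mulr0 // ltnNge ltnW ?lt2.
have ib : supported (l1 ++ [:: i]) (basisv i).
  by apply: supported_basis; rewrite mem_cat inE eqxx orbT.
have := euler_cox ol' ib z1s.
rewrite rword_cat rword_cons mulmx1 -mulmxA rref_basis mulmxN -iE eulerNr => /oppr_inj ->.
rewrite euler_basisl mxE (bigD1 i) //= big1 ?addr0; first by rewrite mxE eqxx zi.
move=> k nki; rewrite mxE eq_sym (negbTE nki); case: ifP => [ik|]; last by rewrite mul0r.
rewrite z1s ?mulr0 // mem_cat inE (negbTE nki) orbF.
by apply/negP => /lt1; rewrite ltnNge ltnW.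
Qed.

Lemma euler_proj l i z : ordered l -> i \in l -> supported l z ->
  euler (projroot l i) z = d i * z i 0.
Proof.
move=> ol il lz; have ul := ordered_uniq ol; have lp := proj_supported il.
by rewrite -[LHS]opprK -(euler_cox ol lp lz) cox_proj // eulerNr opprK euler_inj.
Qed.

(** These are the inversions of the Coxeter element: undoing the letters after the one found by
    [rword_neg] exhibits [x] as a [projroot]. *)
Lemma cox_negP l x : uniq l -> is_posroot x -> ~~ nonneg (rword l *m x) ->
  exists2 i, i \in l & x = projroot l i.
Proof.
move=> ul xp /(rword_neg xp)[l1 [i [l2 [lE h]]]]; exists i.
  by rewrite lE mem_cat inE eqxx orbT.
have il1 : i \notin l1 by move: ul; rewrite lE cat_uniq /= negb_or => /and3P[_ /andP[]].
by rewrite /projroot lE drop_index_cat // -h rwordK.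
Qed.

Lemma proj_cox l i : uniq l -> i \in l -> ~~ nonneg (rword l *m projroot l i).
Proof. by move=> ul il; rewrite cox_proj //; apply/posrootN/inj_posroot. Qed.

Lemma proj_inj l i j : ordered l -> i \in l -> j \in l -> projroot l i = projroot l j -> i = j.
Proof.
move=> ol il jl h; have := euler_proj ol il (supported_basis il).
rewrite h euler_proj //; last exact: supported_basis.
rewrite !basisvE eqxx mulr1; case: eqP => // _ /eqP.
by rewrite mulr0 eq_sym gt_eqF.
Qed.

(** [euler_cox] with both arguments [x] makes [euler x x] its own opposite. *)
Lemma cox_fixed l x : ordered l -> supported l x -> rword l *m x = x -> x = 0.
Proof.
move=> ol lx h; apply: euler_eq0.
by have := euler_cox ol lx lx; rewrite h => /eqP; rewrite -addr_eq0 -mulr2n mulrn_eq0 => /eqP.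
Qed.

(** Substitution along increasing [key]; the unit diagonal keeps the solution integral. *)
Lemma triangular_solve (r : rel 'I_n) (key : 'I_n -> nat) (C : 'I_n -> 'I_n -> int) (b : 'I_n -> int) :
  (forall j k, r j k -> (key k < key j)%N) ->
  exists z : 'I_n -> int, forall j, z j = b j - \sum_(k | r j k) C j k * z k.
Proof.
move=> rkey.
suff /(_ (\max_j key j).+1) [z zE] : forall m, exists z : 'I_n -> int,
    forall j, (key j < m)%N -> z j = b j - \sum_(k | r j k) C j k * z k.
  by exists z => j; apply: zE; rewrite ltnS leq_bigmax.
elim=> [|m [z zE]]; first by exists b.
exists (fun j => b j - \sum_(k | r j k) C j k * z k) => j jm.
congr (_ - _); apply: eq_bigr => k /rkey kj; congr (_ * _).
by apply: zE; apply: leq_trans kj _.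
Qed.

Lemma inj_coord_diag l i : uniq l -> i \in l -> injroot l i i 0 = 1.
Proof.
by move=> ul /(split_uniq ul)[l1 [l2 [_ il1 _ -> _]]]; rewrite rword_coord // basisvE eqxx.
Qed.

Lemma inj_coord_eq0 l i j : ordered l -> i \in l -> j != i -> ~~ (pos j < pos i)%N ->
  injroot l i j 0 = 0.
Proof.
move=> ol il nji nlt; have [l1 [l2 [lE _ _ -> _]]] := split_uniq (ordered_uniq ol) il.
rewrite lE in ol; have [lt1 _ _] := ordered_splitP ol.
by rewrite rword_coord ?basisvE ?(negbTE nji) //; apply: contra nlt => /lt1.
Qed.

(** * Finiteness of the Weyl group and orbits of the Coxeter element *)

Hypothesis rword_bounded : exists L, forall l, exists l',
  rword l' = rword l /\ (size l' <= L)%N.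

Lemma iter_rword l (k : nat) x : iter k (mulmx (rword l)) x = rword (flatten (nseq k l)) *m x.
Proof. by elim: k => [|k ih] /=; rewrite ?mul1mx // ih rword_cat mulmxA. Qed.

(** Every power of the word equals a word of length at most [L]. There are finitely many of those,
    so two powers coincide, and the smaller one cancels. *)
Lemma rword_periodic l : exists2 N, (0 < N)%N & forall x, iter N (mulmx (rword l)) x = x.
Proof.
have [L hL] := rword_bounded.
have /fin_all_exists[g gE] : forall k : 'I_#|{: L.-bseq 'I_n}|.+1,
    exists b : L.-bseq 'I_n, rword b = rword (flatten (nseq k l)).
  by move=> k; have [l' [l'E sz]] := hL (flatten (nseq k l)); exists (Bseq sz).
have /injectivePn[a [b nab gab]] : ~~ injectiveb g.
  by apply/injectiveP => /leq_card; rewrite card_ord ltnn.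
wlog ab : a b nab gab / (a < b)%N.
  move=> H; have : (a : nat) != b by [].
  by rewrite neq_ltn => /orP[|] lt; [apply: (H a b) | apply: (H b a); rewrite // eq_sym].
exists (b - a)%N => [|x]; first by rewrite subn_gt0.
have cancel (k : nat) y z : iter k (mulmx (rword l)) y = iter k (mulmx (rword l)) z -> y = z.
  by elim: k => //= k ih /(congr1 (mulmx (rword (rev l)))); rewrite !rwordK.
apply: (cancel a); rewrite -iterD subnKC ?(ltnW ab) //.
by rewrite !iter_rword -!gE gab.
Qed.

Lemma iter_rword_root l (k : nat) x : is_root x -> is_root (iter k (mulmx (rword l)) x).
Proof. by rewrite iter_rword; apply: rword_root. Qed.

Lemma iter_rword_supported l l' (k : nat) x : {subset l' <= l} -> supported l x ->
  supported l (iter k (mulmx (rword l')) x).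
Proof. by move=> sl lx; elim: k => //= k ih; apply: supported_rword. Qed.

(* Otherwise the sum of the orbit would be a nonzero fixed point of [rword l]. *)
Lemma cox_orbit_neg l u x : ordered l -> is_posroot x -> supported l x ->
  u = l \/ u = rev l -> exists k : nat, ~~ nonneg (iter k (mulmx (rword u)) x).
Proof.
move=> ol xp lx ul; have [N N0 per] := rword_periodic u.
have [/existsP[k kP]|/existsPn h] := boolP [exists k : 'I_N, ~~ nonneg (iter k (mulmx (rword u)) x)].
  by exists k.
have [i xi] := posroot_exists xp.
pose S := \sum_(k < N) iter k (mulmx (rword u)) x.
have uS : rword u *m S = S.
  rewrite /S mulmx_sumr; case: N N0 per h S => // N _ per h _.
  rewrite big_ord_recr big_ord_recl /= [RHS]addrC; congr (_ + _); last exact: per.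
have us : {subset u <= l} by move=> j; case: ul => ->; rewrite ?mem_rev.
have lS : supported l S.
  move=> j jl; rewrite summxE big1 // => k _.
  exact: (iter_rword_supported (l := l)).
have S0 : S = 0.
  apply: (cox_fixed ol lS); case: ul uS => -> // uS.
  by rewrite -[in LHS]uS rwordVK.
have : 0 < S i 0.
  rewrite summxE; case: N N0 per h S uS lS S0 => // N _ per h S uS lS S0.
  rewrite big_ord_recl ltr_wpDr // sumr_ge0 // => k _.
  by have := h (lift ord0 k); rewrite negbK => /nonnegP.
by rewrite S0 mxE ltxx.
Qed.

(** The last vector before the orbit first loses positivity is a [projroot] by [cox_negP]. *)
Lemma cox_path l x : ordered l -> is_posroot x -> supported l x -> exists (k : nat) i,
  [/\ i \in l, iter k (mulmx (rword l)) x = projroot l i &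
      forall j : nat, (j <= k)%N -> nonneg (iter j (mulmx (rword l)) x)].
Proof.
move=> ol xp lx.
have ex := cox_orbit_neg ol xp lx (or_introl erefl).
case: (ex_minnP ex) => [[|k] kP kmin]; first by case: xp kP => _ /= ->.
have orbit_pos (j : nat) : (j <= k)%N -> nonneg (iter j (mulmx (rword l)) x).
  by move=> jk; apply: contraT => /kmin; rewrite ltnNge jk.
have [|i il iE] := cox_negP (ordered_uniq ol) _ kP; last by exists k, i.
by split; [apply: iter_rword_root; case: xp | exact: orbit_pos].
Qed.

(** * Almost positive roots, their compatibility and the action of [tau] *)

(* The objects of a parabolic with vertices [l] are the almost positive roots: [inl i]
   stands for [- projroot l i], that is, for the weight [omega i] when [l] is everything. *)
Definition obj : Type := 'I_n + 'cV[int]_n.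
Implicit Types (o : obj) (s : seq obj).

Definition is_obj l o : Prop :=
  match o with inl i => i \in l | inr x => is_posroot x /\ supported l x end.

Definition compat o o' : bool :=
  match o, o' with
  | inl _, inl _ => true
  | inl i, inr x | inr x, inl i => x i 0 == 0
  | inr x, inr y => (0 <= euler x y) && (0 <= euler y x)
  end.

Lemma compatC o o' : compat o o' = compat o' o.
Proof. by case: o o' => [i|x] [j|y] //=; rewrite andbC. Qed.

(** The Coxeter element sends [- projroot l i] to [injroot l i]. Where it would make a positive root
    negative, at [projroot l i], the rule [- omega i] to [omega i] of [tau] takes over. *)
Definition obj_tau l o : obj :=
  match o with
  | inl i => inr (injroot l i)
  | inr x => if [pick i | (i \in l) && (x == projroot l i)] is Some i then inl i
             else inr (rword l *m x)
  end.

Lemma obj_tau_proj l i : ordered l -> i \in l -> obj_tau l (inr (projroot l i)) = inl i.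
Proof.
move=> ol il /=; case: pickP => [j /andP[jl /eqP /(proj_inj ol il jl) -> //]|/(_ i)].
by rewrite il eqxx.
Qed.

Lemma obj_tau_cox l x : ordered l -> nonneg (rword l *m x) -> obj_tau l (inr x) = inr (rword l *m x).
Proof.
move=> ol h /=; case: pickP => // i /andP[il /eqP xE].
by move: h; rewrite xE (negbTE (proj_cox (ordered_uniq ol) il)).
Qed.

Variant obj_cases l : obj -> obj -> Prop :=
| ObjNegProj i of i \in l : obj_cases l (inl i) (inr (injroot l i))
| ObjProj i of i \in l : obj_cases l (inr (projroot l i)) (inl i)
| ObjCox x of is_posroot x & supported l x & is_posroot (rword l *m x) :
    obj_cases l (inr x) (inr (rword l *m x)).

Lemma obj_tauP l o : ordered l -> is_obj l o -> obj_cases l o (obj_tau l o).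
Proof.
move=> ol; case: o => [i il|x [xp lx]]; first exact: ObjNegProj.
have [cp|/(cox_negP (ordered_uniq ol) xp)[i il ->]] := boolP (nonneg (rword l *m x)).
  by rewrite obj_tau_cox //; apply: ObjCox => //; split=> //; apply: rword_root; case: xp.
by rewrite obj_tau_proj //; apply: ObjProj.
Qed.

Lemma obj_tau_obj l o : ordered l -> is_obj l o -> is_obj l (obj_tau l o).
Proof.
move=> ol ho; case: (obj_tauP ol ho) => [i il|i il|x xp lx cp] //=.
  by split; [apply: inj_posroot => //; apply: ordered_uniq | exact: inj_supported].
by split=> //; apply: supported_rword.
Qed.

(** If the inverse word makes [x] negative, the opposite of the result is some [projroot l i], and
    [inl i] is the preimage. *)
Lemma obj_tau_surj l o : ordered l -> is_obj l o -> exists2 o', is_obj l o' & obj_tau l o' = o.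
Proof.
move=> ol; have ul := ordered_uniq ol; case: o => [i il|x [xp lx]].
  exists (inr (projroot l i)); last exact: obj_tau_proj.
  by split; [exact: proj_posroot | exact: proj_supported].
have yr : is_root (rword (rev l) *m x) by apply: rword_root; case: xp.
have ly : supported l (rword (rev l) *m x).
  by apply: supported_rword => // j; rewrite mem_rev.
have [yp|/(negrootP yr) yn] := boolP (nonneg (rword (rev l) *m x)).
  exists (inr (rword (rev l) *m x)) => //.
  by rewrite obj_tau_cox // rwordVK //; case: xp.
have [|i il iE] := cox_negP ul yn; first by rewrite mulmxN rwordVK posrootN.
exists (inl i) => //=; congr inr; apply/oppr_inj.
by rewrite -cox_proj // -iE mulmxN rwordVK.
Qed.

Lemma obj_tau_inj l o o' : ordered l -> is_obj l o -> is_obj l o' -> obj_tau l o = obj_tau l o' -> o = o'.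
Proof.
move=> ol ho ho'; have ul := ordered_uniq ol.
have cancel y z : rword l *m y = rword l *m z -> y = z.
  by move=> /(congr1 (mulmx (rword (rev l)))); rewrite !rwordK.
have inj_cox i x : i \in l -> is_posroot x -> injroot l i <> rword l *m x.
  move=> il xp; rewrite -[injroot l i]opprK -cox_proj // -mulmxN => /cancel xE.
  by case: xp => _; rewrite -xE (negbTE (posrootN (proj_posroot ul il))).
case: (obj_tauP ol ho) => [i il|i il|x xp lx cp]; case: (obj_tauP ol ho') => [j jl|j jl|y yp ly cq] //.
- by case=> /(congr1 -%R); rewrite -!cox_proj // => /cancel /(proj_inj ol il jl) ->.
- by case=> h; case: (inj_cox _ _ il yp h).
- by case=> ->.
- by case=> h; case: (inj_cox _ _ jl xp (esym h)).
- by case=> /cancel ->.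
Qed.

(** Roots that stay positive are covered by [euler_cox_isom]; in the other cases [euler_proj] and
    [euler_inj] turn Euler values into coordinates. *)
Lemma obj_tau_compat l o o' : ordered l -> is_obj l o -> is_obj l o' ->
  compat (obj_tau l o) (obj_tau l o') = compat o o'.
Proof.
move=> ol ho ho'; have ul := ordered_uniq ol.
have dne i : (d i == 0) = false by rewrite gt_eqF.
have coord x i : is_posroot x -> 0 <= x i 0 by case=> _ /nonnegP.
have dge x i : is_posroot x -> 0 <= d i * x i 0.
  by move=> xp; rewrite mulr_ge0 ?coord // ltW.
have dle x i : is_posroot x -> (0 <= - (d i * x i 0)) = (x i 0 == 0).
  by move=> xp; rewrite oppr_ge0 -[LHS]andbT -(dge x i xp) -eq_le mulf_eq0 dne.
have Ip i : i \in l -> is_posroot (injroot l i) by exact: inj_posroot.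
have Is i : i \in l -> supported l (injroot l i) by exact: inj_supported.
have Pp i : i \in l -> is_posroot (projroot l i) by exact: proj_posroot.
have Ps i : i \in l -> supported l (projroot l i) by exact: proj_supported.
(* Up to the factors [d j] and [d i], both coordinates equal
   [euler (projroot l j) (injroot l i)]. *)
have IP i j : i \in l -> j \in l -> (injroot l i j 0 == 0) = (projroot l j i 0 == 0).
  move=> il jl; have := euler_inj ol il (Ps _ jl); rewrite euler_proj //; last exact: Is.
  by move=> /(congr1 (fun t => t == 0)); rewrite !mulf_eq0 !dne /= => ->.
have Cs x : supported l x -> supported l (rword l *m x).
  exact: supported_rword.
(* One of the two inequalities is automatic; the other reads [0 <= - (d i * x i 0)], so the
   coordinate vanishes. *)
have IC i x : i \in l -> is_posroot x -> supported l x -> is_posroot (rword l *m x) ->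
    compat (inr (injroot l i)) (inr (rword l *m x)) = (x i 0 == 0).
  move=> il xp lx cp /=; rewrite euler_cox ?euler_inj ?dle ?dge ?andbT //; try exact: Is; exact: Cs.
have PC i x : i \in l -> is_posroot x -> supported l x -> is_posroot (rword l *m x) ->
    compat (inr (projroot l i)) (inr x) = ((rword l *m x) i 0 == 0).
  move=> il xp lx cp /=; rewrite euler_proj // dge //=.
  rewrite -[euler x _]opprK -(euler_cox ol lx (Ps _ il)) euler_proj ?dle //; exact: Cs.
case: (obj_tauP ol ho) => [i il|i il|x xp lx cp]; case: (obj_tauP ol ho') => [j jl|j jl|y yp ly cq].
- rewrite /= !euler_inj ?dge //; try exact: Ip; exact: Is.
- by rewrite /= IP.
- by rewrite IC.
- by rewrite /= IP.
- rewrite /= !euler_proj ?dge //; try exact: Pp; exact: Ps.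
- by rewrite PC.
- by rewrite compatC IC.
- by rewrite [RHS]compatC PC.
- by rewrite /= !euler_cox_isom.
Qed.

Lemma iter_tau_cox l x (k : nat) : ordered l ->
  (forall j : nat, (j <= k)%N -> nonneg (iter j (mulmx (rword l)) x)) ->
  iter k (obj_tau l) (inr x) = inr (iter k (mulmx (rword l)) x).
Proof.
move=> ol; elim: k => //= k ih h; rewrite ih => [|j jk]; last by apply: h; apply: leqW.
by rewrite obj_tau_cox //; apply: (h k.+1).
Qed.

Lemma obj_tau_reaches_inl l o : ordered l -> is_obj l o -> exists (k : nat) i, iter k (obj_tau l) o = inl i.
Proof.
move=> ol; case: o => [i _|x [xp lx]]; first by exists 0, i.
have [k [i [il kE kp]]] := cox_path ol xp lx.
by exists k.+1, i; rewrite iterS iter_tau_cox // kE obj_tau_proj.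
Qed.

(** * Clusters of almost positive roots and the induction on the rank *)

Definition is_obj_cluster l s : Prop :=
  [/\ uniq s, {in s, forall o, is_obj l o}, {in s &, forall o o', compat o o'} &
      forall o, is_obj l o -> {in s, forall o', compat o o'} -> o \in s].

(** The value 0 at [inl i] lets sums run over a whole cluster while only its positive roots
    contribute. *)
Definition obj_root o : 'cV[int]_n := if o is inr x then x else 0.

Definition roots_span l s : Prop :=
  forall v, supported l v -> (forall i, inl i \in s -> v i 0 = 0) ->
  exists a : obj -> int, v = \sum_(o <- s) a o *: obj_root o.

Lemma sum_inl (V : zmodType) (g : 'I_n -> V) s : uniq s ->
  \sum_(o <- s) (if o is inl i then g i else 0) = \sum_(i | inl i \in s) g i.
Proof.
elim: s => [|o s ih] /=; first by rewrite big_nil big_pred0_eq.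
case/andP => os us; rewrite big_cons ih //.
case: o os => [i|x] os; last by rewrite add0r; apply: eq_bigl => i; rewrite inE.
rewrite [RHS](bigD1 i) ?inE ?eqxx //; congr (_ + _); apply: eq_bigl => j.
rewrite inE -[inl j == inl i]/(j == i); case: eqVneq => [->|] /=; last by rewrite andbT.
by rewrite (negbTE os).
Qed.

(** Compatibility with [inl i] puts the positive roots of [s] in the parabolic without [i]. Since
    [compat] does not refer to [l], maximality passes down. *)
Lemma cluster_remove l s i : is_obj_cluster l s -> inl i \in s -> ordered l ->
  [/\ i \in l, is_obj_cluster (rem i l) (rem (inl i) s) &
      roots_span (rem i l) (rem (inl i) s) -> roots_span l s].
Proof.
move=> [us so sc smax] si ol; have ul := ordered_uniq ol; have il : i \in l := so _ si.
have memr o : (o \in rem (inl i) s) = (o != inl i) && (o \in s) by rewrite mem_rem_uniq // inE.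
have meml j : (j \in rem i l) = (j != i) && (j \in l) by rewrite mem_rem_uniq // inE.
have supp x : supported (rem i l) x <-> supported l x /\ x i 0 = 0.
  split=> [h|[h xi] j]; first split=> [j jl|]; try apply: h.
  - by rewrite meml negb_and jl orbT.
  - by rewrite meml eqxx.
  - by rewrite meml negb_and negbK => /orP[/eqP ->|/h].
split=> //.
  split=> [|o|o o'|o ho hc].
  - exact: rem_uniq.
  - rewrite memr => /andP[oi os]; have := so _ os; have := sc _ _ si os.
    case: o oi os => [j|x] /= oi os; first by move=> _; rewrite meml => ->; rewrite andbT.
    by move=> /eqP xi [xp lx]; split=> //; apply/supp.
  - by rewrite !memr => /andP[_ os] /andP[_ os']; apply: sc.
  - have [ho' oi compi] : [/\ is_obj l o, o != inl i & compat o (inl i)].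
      case: o ho {hc} => [j|x] /=; first by rewrite meml => /andP[ji jl]; split.
      by move=> [xp /supp[lx /eqP xi]]; split.
    rewrite memr oi; apply: smax => // o' os'.
    by have [->//|noi] := eqVneq o' (inl i); apply: hc; rewrite memr noi.
move=> span v lv vs; have [||a vE] := span v.
- by apply/supp; split=> //; apply: vs.
- by move=> j; rewrite memr => /andP[_ /vs].
by exists a; rewrite (perm_big _ (perm_to_rem si)) big_cons /= scaler0 add0r.
Qed.

Lemma cluster_tau l s : is_obj_cluster l s -> ordered l -> is_obj_cluster l (map (obj_tau l) s).
Proof.
move=> [us so sc smax] ol.
have rinj : {in s &, injective (obj_tau l)}.
  by move=> o o' /so ho /so ho'; apply: obj_tau_inj.
split.
- by rewrite map_inj_in_uniq.
- by move=> _ /mapP[o /so ho ->]; apply: obj_tau_obj.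
- move=> _ _ /mapP[o os ->] /mapP[o' os' ->]; rewrite obj_tau_compat //; try exact: so.
  exact: sc.
move=> _ /(obj_tau_surj ol)[o ho <-] hc; apply: map_f; apply: smax => // o' os'.
by rewrite -(obj_tau_compat ol ho (so _ os')); apply: hc; apply: map_f.
Qed.

(* The vectors [injroot l i] with [inl i] in the image cluster are unitriangular on the
   coordinates killed there, so they complete its roots to a generating family. *)
Lemma obj_tau_roots_span l s : is_obj_cluster l s -> ordered l -> (forall i, inl i \notin s) ->
  roots_span l (map (obj_tau l) s) -> roots_span l s.
Proof.
move=> scl ol snl span v lv _; have ul := ordered_uniq ol.
have [us' so' _ _] := cluster_tau scl ol; case: scl => us so _ _.
set s' := map (obj_tau l) s in span us' so'.
pose w := rword l *m v.
have lw : supported l w by exact: supported_rword.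
(* Besides its diagonal coordinate, [injroot l k] is nonzero only at letters before [k]. The system
   that kills [u j 0] whenever [inl j \in s'] is thus solved from the last position down; the key
   [P - pos k] reverses the order. *)
pose P := \max_k pos k.
have [b bE] := @triangular_solve (fun j k => pos j < pos k)%N (fun k => P - pos k)%N
  (fun j k => if inl k \in s' then injroot l k j 0 else 0) (fun j => - w j 0)
  (fun j k jk => ltn_sub2l (leq_trans jk (leq_bigmax k)) jk).
pose u := w + \sum_(i | inl i \in s') b i *: injroot l i.
have lu : supported l u.
  apply: supportedD => // j jl; rewrite summxE big1 // => i /so' /= il.
  by rewrite [LHS]mxE (inj_supported il) // mulr0.
have uz j : inl j \in s' -> u j 0 = 0.
  move=> js'; rewrite mxE summxE (bigD1 j) //= scale_coord inj_coord_diag ?mulr1; last 2 first.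
  - by [].
  - exact: (so' _ js').
  rewrite bE (_ : \sum_(k | _) _ = \sum_(i | (inl i \in s') && (i != j)) (b i *: injroot l i) j 0).
    by ring.
  rewrite big_mkcond [RHS]big_mkcond; apply: eq_bigr => i _.
  have [is'|] := boolP (inl i \in s'); last by rewrite mul0r; case: ifP.
  have [->|nij] := eqVneq i j; first by rewrite ltnn.
  rewrite scale_coord mulrC; case: ifP => //= /negbT nlt.
  by rewrite inj_coord_eq0 ?mulr0 // 1?eq_sym //; apply: (so' _ is').
have [a uE] := span u lu uz.
(* An image [inl i] comes from [projroot l i], which the Coxeter element sends to [- injroot l i];
   hence the coefficient [b i]. *)
exists (fun o => if obj_tau l o is inl i then b i else a (obj_tau l o)).
apply: (can_inj (rwordK l)); rewrite -/w.
have -> : w = u - \sum_(i | inl i \in s') b i *: injroot l i by rewrite addrK.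
rewrite uE -sum_inl // /s' !big_map -sumrB mulmx_sumr big_seq [RHS]big_seq.
apply: eq_bigr => o os; rewrite -scalemxAr.
move: (so _ os) => ho; case: (obj_tauP ol ho) os => [i _ os|i il _|x _ _ _ _] /=; last by rewrite subr0.
  by have := snl i; rewrite os.
by rewrite cox_proj // scaler0 sub0r scalerN.
Qed.

Theorem obj_cluster_basis l s : ordered l -> is_obj_cluster l s ->
  size s = size l /\ roots_span l s.
Proof.
move: {2}(size l) (erefl (size l)) => m; elim: m l s => [|m ih] l s szl ol scl.
  move/size0nil: szl => l0; rewrite l0 in scl *; case: scl => us so _ _.
  suff -> : s = [::].
    split=> // v lv _; exists (fun=> 0); rewrite big_nil.
    by apply/colP => i; rewrite lv // mxE.
  case: s {us} so => // o s /(_ o (mem_head _ _)); case: o => [//|x [xp lx]].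
  by have [i] := posroot_exists xp; rewrite lx // ltxx.
have base t i : is_obj_cluster l t -> inl i \in t -> size t = size l /\ roots_span l t.
  move=> tcl ti; have [il tcl' span] := cluster_remove tcl ti ol.
  have [||szt spant] := ih (rem i l) (rem (inl i) t) _ _ tcl'.
  - by rewrite size_rem // szl.
  - by apply: subseq_pairwise ol; apply: rem_subseq.
  split; last exact: span.
  by move: szt; rewrite !size_rem // szl /=; case: (t) ti => //= o t' _ ->.
(* The inner induction is on the number [k] of [obj_tau] steps that take some member of the cluster
   to an [inl i]. *)
suff main (k : nat) t o i : is_obj_cluster l t -> o \in t -> iter k (obj_tau l) o = inl i ->
    size t = size l /\ roots_span l t.
  (* An empty cluster is not maximal when [l] is nonempty: [inl j] is vacuously compatible with
     it. *)
  case: s scl => [[_ _ _ smax]|o s scl].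
    case: l szl {ol ih base main} smax => // j l _ /(_ (inl j)).
    rewrite /is_obj mem_head => /(_ isT) h.
    by have /h : {in [::], forall o', compat (inl j) o'}.
  have os : o \in o :: s by exact: mem_head.
  have [k [i oi]] : exists (k : nat) i, iter k (obj_tau l) o = inl i.
    by apply: obj_tau_reaches_inl => //; case: scl => _ /(_ o os).
  exact: main scl os oi.
elim: k t o => [|k ihk] t o tcl ot /= oi; first by apply: (base t i) => //; rewrite -oi.
(* [obj_tau_roots_span] requires a cluster without any [inl]; the others fall to [base] at once. *)
have [/existsP[j jt]|/existsPn tnl] := boolP [exists j, inl j \in t]; first exact: base tcl jt.
have [|||szt spant] := ihk (map (obj_tau l) t) (obj_tau l o).
- exact: cluster_tau.
- exact: map_f.
- by rewrite -iterSr.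
by split; [rewrite -szt size_map | apply: obj_tau_roots_span].
Qed.

(** * The Weyl group on weights and its longest element *)

Implicit Types (lam mu : 'cV[int]_n).

Lemma sref_mulE i lam : sref A i *m lam = lam - lam i 0 *: (A *m basisv i).
Proof.
apply/colP => k; rewrite -colE !mxE.
under eq_bigr => j _ do rewrite mxE mulrBl.
rewrite sumrB (bigD1 k) //= big1 => [|j nj]; last by rewrite eq_sym (negbTE nj) mul0r.
rewrite (bigD1 i) //= big1 => [|j nj]; last by rewrite eq_sym (negbTE nj) mulr0 mul0r.
by rewrite !eqxx /=; ring.
Qed.

(** [A] is the inclusion of the root lattice in the weight lattice, written in simple roots and
    fundamental weights. *)
Lemma sref_cartan i x : sref A i *m (A *m x) = A *m (rref i *m x).
Proof. by rewrite sref_mulE rrefE mulmxBr -scalemxAr. Qed.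

Lemma wordmx_cat l1 l2 : wordmx A (l1 ++ l2) = wordmx A l1 *m wordmx A l2.
Proof. by elim: l1 => [|i l1 ih] /=; rewrite ?mul1mx // ih mulmxA. Qed.

Lemma wordmx_cons i l lam : wordmx A (i :: l) *m lam = sref A i *m (wordmx A l *m lam).
Proof. by rewrite mulmxA. Qed.

Lemma wordmx_cartan l x : wordmx A l *m (A *m x) = A *m (rword l *m x).
Proof.
by elim: l => [|i l ih]; rewrite ?mul1mx // wordmx_cons ih sref_cartan (mulmxA (rref i)).
Qed.

Lemma srefK i lam : sref A i *m (sref A i *m lam) = lam.
Proof.
rewrite [LHS]sref_mulE sref_mulE -colE; apply/colP => k; rewrite !mxE A_diag; ring.
Qed.

Lemma wordmxK l lam : wordmx A (rev l) *m (wordmx A l *m lam) = lam.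
Proof.
elim: l lam => [|i l ih] lam; first by rewrite !mul1mx.
by rewrite rev_cons -cats1 wordmx_cat wordmx_cons -mulmxA /= mulmx1 srefK ih.
Qed.

Lemma mulmx_cV_ext (B C : 'M[int]_n) : (forall lam, B *m lam = C *m lam) -> B = C.
Proof.
move=> h; apply/matrixP => i j; have := h (basisv j).
by rewrite -!colE => /colP/(_ i); rewrite !mxE.
Qed.

Lemma wordmx_rword_inj l l' : wordmx A l = wordmx A l' -> rword l = rword l'.
Proof.
move=> h; apply: mulmx_cV_ext => x; apply/eqP; rewrite -subr_eq0; apply/eqP.
by apply: cartan_inj; rewrite mulmxBr -!wordmx_cartan h subrr.
Qed.

(** The invariant form between weights and roots, in which [omega i] and the simple root [i] pair to
    [d i]. *)
Definition pairing lam x : int := \sum_j d j * lam j 0 * x j 0.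

Lemma pairing_basis lam i : pairing lam (basisv i) = d i * lam i 0.
Proof.
rewrite /pairing (bigD1 i) //= big1 ?basisvE ?eqxx ?addr0 ?mulr1 // => j nji.
by rewrite basisvE (negbTE nji) mulr0.
Qed.

Lemma pairing_sref i lam x : pairing (sref A i *m lam) x = pairing lam (rref i *m x).
Proof.
have -> : pairing lam (rref i *m x) = pairing lam x - (A *m x) i 0 * pairing lam (basisv i).
  rewrite rrefE /pairing mulr_sumr -sumrB; apply: eq_bigr => j _.
  by rewrite sub_coord scale_coord; ring.
rewrite pairing_basis mxE mulr_suml sref_mulE -colE /pairing -sumrB; apply: eq_bigr => j _.
rewrite !mxE mulrBr mulrBl; congr (_ - _).
by transitivity (lam i 0 * x j 0 * (d j * A j i)); [ring | rewrite dA_sym; ring].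
Qed.

Lemma pairing_wordmx l lam x : pairing (wordmx A l *m lam) x = pairing lam (rword (rev l) *m x).
Proof.
elim: l x => [|i l ih] x; first by rewrite !mul1mx.
by rewrite wordmx_cons pairing_sref ih rev_cons -cats1 rword_cat /= mulmx1 mulmxA.
Qed.

Lemma pairing_ge0 lam x : nonneg lam -> nonneg x -> 0 <= pairing lam x.
Proof.
move=> /nonnegP lp /nonnegP xp; apply: sumr_ge0 => j _.
by rewrite !mulr_ge0 // ltW.
Qed.

Lemma pairingN lam x : pairing lam (- x) = - pairing lam x.
Proof. by rewrite /pairing -sumrN; apply: eq_bigr => j _; rewrite mxE mulrN. Qed.

(** The conjugation rule for simple reflections. Invariance of [euler x x] gives [d i = d j], and
    [pairing] then equates the two coordinates. *)
Lemma conj_sref l i j : rword l *m basisv i = basisv j ->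
  forall lam, sref A j *m (wordmx A l *m lam) = wordmx A l *m (sref A i *m lam).
Proof.
move=> h lam; rewrite !sref_mulE mulmxBr -scalemxAr wordmx_cartan h.
suff -> : (wordmx A l *m lam) j 0 = lam i 0 by [].
have dij : d i = d j.
  rewrite -!euler_basis -h.
  elim: (l) => [|a t ih]; first by rewrite mul1mx.
  by rewrite rword_cons -mulmxA euler_rref.
have := pairing_wordmx l lam (basisv j).
rewrite -{2}h rwordK !pairing_basis dij; apply: mulfI.
by rewrite gt_eqF.
Qed.

(** The exchange condition: [rword_neg] finds a letter conjugate to [j], and moving the reflection
    [j] up to it by [conj_sref] cancels both. *)
Lemma exchange l j : ~~ nonneg (rword (rev l) *m basisv j) ->
  exists2 l', wordmx A (j :: l) = wordmx A l' & size l = (size l').+1.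
Proof.
move=> /(rword_neg (posroot_basis j))[l1 [i [l2 [lE h]]]].
have {}lE : l = rev l2 ++ i :: rev l1.
  by rewrite -[LHS]revK lE rev_cat rev_cons cat_rcons.
have hj : rword (rev l2) *m basisv i = basisv j by rewrite -h rwordK.
exists (rev l2 ++ rev l1); last by rewrite lE !size_cat /= addnS.
apply: mulmx_cV_ext => lam; rewrite wordmx_cons lE !wordmx_cat -!mulmxA (conj_sref hj).
by rewrite srefK.
Qed.

(** Induction on the length. If the inverse of [l] keeps the simple root [i] positive, the outer
    reflection subtracts a nonnegative multiple of it; otherwise [exchange] shortens the word. *)
Lemma dominant_le l lam : nonneg lam ->
  exists2 y, nonneg y & lam - wordmx A l *m lam = A *m y.
Proof.
move=> lp; have [m] := ubnP (size l); elim: m l => // m ih [|i l] /=; rewrite ltnS => szl.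
  exists 0; last by rewrite mul1mx subrr mulmx0.
  by apply/nonnegP => j; rewrite mxE.
have [rp|/exchange[l' l'E sz]] := boolP (nonneg (rword (rev l) *m basisv i)).
  have [y yp yE] := ih l szl.
  exists (y + (wordmx A l *m lam) i 0 *: basisv i); last first.
    by rewrite mulmxDr -yE -scalemxAr -mulmxA sref_mulE opprB addrCA addrC.
  have lp' : 0 <= (wordmx A l *m lam) i 0.
    have := pairing_ge0 lp rp; rewrite -pairing_wordmx pairing_basis.
    by rewrite pmulr_rge0.
  move/nonnegP: yp => yp; apply/nonnegP => j; rewrite mxE scale_coord basisvE.
  by rewrite addr_ge0 // mulr_ge0.
by rewrite -[sref A i *m _]/(wordmx A (i :: l)) l'E; apply: ih; rewrite -sz ltnW.
Qed.

Lemma dominant_unique l lam mu : nonneg lam -> nonneg mu -> wordmx A l *m lam = mu -> lam = mu.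
Proof.
move=> lp mp h.
have [y /nonnegP yp yE] := dominant_le l lp; rewrite h in yE.
have [z /nonnegP zp zE] := dominant_le (rev l) mp; rewrite -{2}h wordmxK in zE.
have /colP yz : y + z = 0 by apply: cartan_inj; rewrite mulmxDr -yE -zE addrA subrK subrr.
suff y0 : y = 0 by apply/eqP; rewrite -subr_eq0 yE y0 mulmx0.
apply/colP => j; have := yz j; rewrite !mxE => /eqP.
by rewrite paddr_eq0 // => /andP[/eqP].
Qed.

(** If coordinate [j] of [w0 *m lam] were positive, the inverse of [w0] would keep the simple root
    [j] positive. A word [t] of length at most [L] for [s_j w0] would then allow an exchange, giving
    a word for [w0] shorter than [L]. *)
Lemma longest_antidominant w0 lam : is_longest A w0 -> nonneg lam -> nonneg (- (w0 *m lam)).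
Proof.
move=> [L [[l [szl lE]] [lmin lbound]]] lp; apply: contraT => /forallPn[j].
rewrite mxE oppr_ge0 -ltNge -lE => lj.
pose r := rword (rev l) *m basisv j.
have rp : nonneg r.
  have [//|rn] : nonneg r \/ nonneg (- r) by apply/root_sign/rword_root/is_root_basis.
  have := pairing_ge0 lp rn; rewrite pairingN -pairing_wordmx pairing_basis oppr_ge0.
  by rewrite pmulr_rle0 // leNgt lj.
have [t [tE szt]] := lbound (j :: l).
have rt : rword (rev t) = rword (rev (j :: l)).
  rewrite -[LHS]mulmx1 -(rwordVr (j :: l)) -(wordmx_rword_inj tE) mulmxA rwordVl.
  by rewrite mul1mx.
have [|t' t'E sz] := @exchange t j.
  rewrite rt rev_cons -cats1 rword_cat /= mulmx1 -mulmxA rref_basis mulmxN.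
  apply: posrootN; split=> //; exact/rword_root/is_root_basis.
have t'w0 : wordmx A t' = w0.
  by rewrite -t'E; apply: mulmx_cV_ext => v; rewrite wordmx_cons tE wordmx_cons srefK lE.
by have := lmin t' t'w0; rewrite leqNgt -sz szt.
Qed.

(** The opposites of the two images are dominant and conjugate, so any word making [lam]
    antidominant computes [w0 *m lam]. *)
Lemma longest_unique w0 l lam mu : is_longest A w0 -> nonneg lam -> nonneg (- mu) ->
  wordmx A l *m lam = mu -> w0 *m lam = mu.
Proof.
move=> w0l lp mp h; have ap := longest_antidominant w0l lp.
have [L [[l0 [_ l0E]] _]] := w0l; apply/oppr_inj.
apply: (@dominant_unique (l ++ rev l0)) => //.
by rewrite wordmx_cat -mulmxA mulmxN -l0E wordmxK mulmxN h.
Qed.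

Lemma euler_sumr_big (I : Type) (r : seq I) (F : I -> 'cV[int]_n) z :
  euler z (\sum_(a <- r) F a) = \sum_(a <- r) euler z (F a).
Proof.
elim: r => [|a r ih]; first by rewrite !big_nil /euler mulmx0 mxE.
by rewrite !big_cons eulerDr ih.
Qed.

Lemma euler_coord_eq0 x : (forall j, euler x (basisv j) = 0) -> x = 0.
Proof.
move=> h; apply: euler_eq0; rewrite {2}(cV_sum_basisv x) euler_sumr_big big1 // => j _.
by rewrite eulerZr h mulr0.
Qed.

Lemma euler_nondegr x : (forall z, euler z x = 0) -> x = 0.
Proof. by move=> h; apply: euler_eq0. Qed.

(* The inverse of [c^-1 - 1 : P -> Q]. *)
Definition weightmx : 'M[int]_n :=
  \matrix_(j, k) - (if j == k then 1 else if (pos k < pos j)%N then A j k else 0).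

(** So [weightmx *m x] is the functional [- euler x] read as a weight through [pairing]. *)
Lemma weight_coord x j : d j * (weightmx *m x) j 0 = - euler x (basisv j).
Proof.
rewrite euler_basisr !mxE mulr_sumr -sumrN; apply: eq_bigr => k _.
rewrite !mxE [k == j]eq_sym mulrA mulrN mulNr; congr (- (_ * _)).
case: eqVneq => [->|_]; first by rewrite mulr1.
by case: ifP => _; rewrite ?mulr0 // dA_sym.
Qed.

Lemma weight_eq x y : (forall j, euler x (basisv j) = euler y (basisv j)) -> x = y.
Proof.
by move=> h; apply/eqP; rewrite -subr_eq0; apply/eqP/euler_coord_eq0 => j; rewrite eulerBl h subrr.
Qed.

Lemma weight_inj x y : weightmx *m x = weightmx *m y -> x = y.
Proof.
by move=> h; apply: weight_eq => j; apply: oppr_inj; rewrite -!weight_coord h.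
Qed.

Lemma omegaE i : omega i = basisv i.
Proof. by apply/colP => j; rewrite basisvE mxE. Qed.

Lemma alphaE i : alpha A i = A *m basisv i.
Proof. by apply/colP => j; rewrite -colE !mxE. Qed.

Lemma sref_omega i j : i != j -> sref A i *m omega j = omega j.
Proof. by move=> nij; rewrite sref_mulE !omegaE basisvE (negbTE nij) scale0r subr0. Qed.

Lemma wordmx_omega l j : j \notin l -> wordmx A l *m omega j = omega j.
Proof.
elim: l => [|i l ih]; first by rewrite mul1mx.
rewrite inE negb_or => /andP[nji jl]; rewrite wordmx_cons ih // sref_omega //.
by rewrite eq_sym.
Qed.

(** * Identification of [Pi(c)] with the almost positive roots *)

Section FullCoxeter.

Variable l : seq 'I_n.
Hypothesis ol : ordered l.
Hypothesis fl : forall i, i \in l.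

Let c := wordmx A l.
Let cr := rword l.

Let supp x : supported l x. Proof. by move=> j; rewrite fl. Qed.
Let ul : uniq l := ordered_uniq ol.

Lemma weight_proj i : weightmx *m projroot l i = - omega i.
Proof.
apply/colP => j; apply: (mulfI (_ : d j != 0)); first by rewrite gt_eqF.
rewrite weight_coord euler_proj // omegaE opp_coord !basisvE mulrN.
by rewrite eq_sym; case: eqP => [->|_]; rewrite ?mulr1 ?mulr0.
Qed.

(** [euler_cox] turns the difference into the two halves of the symmetrized form. *)
Lemma weight_cox x : weightmx *m x - weightmx *m (cr *m x) = A *m (cr *m x).
Proof.
apply/colP => j; apply: (mulfI (_ : d j != 0)); first by rewrite gt_eqF.
by rewrite sub_coord mulrBr !weight_coord -euler_basis_sym opprK euler_cox.
Qed.

(** All letters other than [i] fix [omega i]; the letter [i] subtracts its simple root, which the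
    letters before it carry to [injroot l i]. *)
Lemma cox_omega i : c *m omega i = omega i - A *m injroot l i.
Proof.
have [l1 [l2 [lE il1 il2 -> _]]] := split_uniq ul (fl i).
rewrite /c lE wordmx_cat -mulmxA wordmx_cons wordmx_omega // sref_mulE omegaE.
by rewrite basisvE eqxx scale1r mulmxBr wordmx_cartan -omegaE wordmx_omega.
Qed.

(** Both sides pair equally with every [z] under [euler], the vectors [injroot l i] reading off the
    coordinates of [z]. *)
Lemma cox_sum_inj x : cr *m x = \sum_i (weightmx *m x) i 0 *: injroot l i.
Proof.
apply/eqP; rewrite -subr_eq0; apply/eqP/euler_nondegr => z.
rewrite eulerBr euler_cox // euler_sumr_big; apply/eqP; rewrite subr_eq0; apply/eqP.
rewrite {1}(cV_sum_basisv z) euler_sumr_big -sumrN; apply: eq_bigr => i _.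
by rewrite !eulerZr euler_inj // mulrCA mulrA weight_coord mulNr mulrC.
Qed.

(** Expanding the weight in the [omega i] and applying [cox_omega] subtracts [A *m (cr *m x)], by
    [cox_sum_inj]; [weight_cox] concludes. *)
Lemma weight_equivariant x : c *m (weightmx *m x) = weightmx *m (cr *m x).
Proof.
rewrite {1}(cV_sum_basisv (weightmx *m x)) mulmx_sumr.
under eq_bigr => i _ do rewrite -scalemxAr -omegaE cox_omega scalerBr omegaE scalemxAr.
rewrite sumrB -cV_sum_basisv -mulmx_sumr -cox_sum_inj -weight_cox.
by rewrite opprB addrC subrK.
Qed.

Lemma weight_equivariant_iter (k : nat) x :
  iter k (mulmx c) (weightmx *m x) = weightmx *m iter k (mulmx cr) x.
Proof. by elim: k => //= k ->; rewrite weight_equivariant. Qed.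

Lemma cox_omega_weight i : c *m omega i = weightmx *m injroot l i.
Proof.
by rewrite -[omega i]opprK -weight_proj -mulmxN weight_equivariant mulmxN cox_proj // opprK.
Qed.

Lemma mxpowE (k : nat) lam : mxpow c k *m lam = iter k (mulmx c) lam.
Proof. by elim: k => [|k ih] /=; rewrite ?mul1mx // -ih mulmxA. Qed.

Lemma mxpow_omega (k : nat) i :
  mxpow c k.+1 *m omega i = weightmx *m iter k (mulmx cr) (injroot l i).
Proof. by rewrite mxpowE iterSr cox_omega_weight weight_equivariant_iter. Qed.

Definition almost_root o : 'cV[int]_n :=
  match o with inl i => - projroot l i | inr x => x end.
Definition obj_weight o : 'cV[int]_n := 
  match o with inl i => omega i | inr x => weightmx *m x end.

Lemma obj_weightE o : obj_weight o = weightmx *m almost_root o.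
Proof. by case: o => [i|x] //=; rewrite mulmxN weight_proj opprK. Qed.

Lemma obj_weight_inj o o' : is_obj l o -> is_obj l o' -> obj_weight o = obj_weight o' -> o = o'.
Proof.
have mixed i x : is_posroot x -> - projroot l i <> x.
  by case=> _ xp xE; have := posrootN (proj_posroot ul (fl i)); rewrite xE xp.
rewrite !obj_weightE => ho ho' /weight_inj.
case: o o' ho ho' => [i|x] [j|y] /=.
- by move=> _ _ /oppr_inj /(proj_inj ol (fl i) (fl j)) ->.
- by move=> _ [yp _] /mixed; case.
- by move=> [xp _] _ /esym /mixed; case.
- by move=> _ _ ->.
Qed.

Lemma tau_obj_weight o : is_obj l o -> tau c (obj_weight o) = obj_weight (obj_tau l o).
Proof.
move=> ho; rewrite /tau; case: (obj_tauP ol ho) => [i _|i _|x xp _ [_ cp]] /=.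
- case: existsP => [[j /eqP/colP/(_ i)]|_]; last exact: cox_omega_weight.
  rewrite omegaE opp_coord omegaE !basisvE eqxx => /eqP.
  by case: (i == j).
- by case: existsP => [|[]]; [rewrite weight_proj opprK | exists i; rewrite weight_proj].
- case: existsP => [[j /eqP]|_]; last exact: weight_equivariant.
  rewrite -weight_proj => /weight_inj xE; move: cp.
  by rewrite xE (negbTE (proj_cox ul (fl j))).
Qed.

Lemma cox_invE o : invmx c *m obj_weight o - obj_weight o = A *m almost_root o.
Proof.
have cu : c \in unitmx.
  suff /mulmx1_unit[] : wordmx A (rev l) *m c = 1%:M by [].
  by apply: mulmx_cV_ext => lam; rewrite mul1mx -mulmxA wordmxK.
rewrite obj_weightE; have := rwordVK l (almost_root o).
set y := rword (rev l) *m _ => <-.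
by rewrite -weight_cox -weight_equivariant mulKmx.
Qed.

Lemma alpha_sum x : A *m x = \sum_j x j 0 *: alpha A j.
Proof.
rewrite {1}(cV_sum_basisv x) mulmx_sumr; apply: eq_bigr => j _.
by rewrite -scalemxAr alphaE.
Qed.

Variable w0 : 'M[int]_n.
Hypothesis w0_longest : is_longest A w0.

(** The orbit from [omega i] passes through the weights of positive roots up to some [projroot l j],
    of weight [- omega j]; this is [w0 *m omega i] by [longest_unique]. An earlier visit is
    impossible, since the step after [projroot l j] is negative. The extra 1 in [k.+1] is the step
    from [omega i] to [injroot l i]. *)
Lemma is_h_cox_path i : exists (k : nat) j,
  [/\ is_h c w0 i k.+1, iter k (mulmx cr) (injroot l i) = projroot l j &
      forall m : nat, (m <= k)%N -> nonneg (iter m (mulmx cr) (injroot l i))].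
Proof.
have [k [j [_ kE kp]]] := cox_path ol (inj_posroot ul (fl i)) (@supp _).
have hE : mxpow c k.+1 *m omega i = - omega j by rewrite mxpow_omega kE weight_proj.
exists k, j; split=> //.
have w0i : w0 *m omega i = - omega j.
  apply: (@longest_unique _ (flatten (nseq k.+1 l))) => //; rewrite ?opprK ?omegaE ?nonneg_basis //.
  rewrite -!omegaE -hE mxpowE; elim: (k.+1) => /= [|m ih]; first by rewrite mul1mx.
  by rewrite wordmx_cat -mulmxA ih.
split=> //; split=> [|[//|m] _ mk]; first by rewrite w0i.
rewrite w0i mxpow_omega -weight_proj => /weight_inj mE.
have := kp m.+1 mk; rewrite /= mE -/cr.
by rewrite (negbTE (proj_cox ul (fl j))).
Qed.

Lemma is_h_uniq i h h' : is_h c w0 i h -> is_h c w0 i h' -> h = h'.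
Proof.
move=> [h0 [hE hmin]] [h0' [hE' hmin']]; case: (ltngtP h h') => // lt.
  by case: (hmin' _ h0 lt).
by case: (hmin _ h0' lt).
Qed.

Lemma inPi_obj lam : inPi c w0 lam -> exists2 o, is_obj l o & lam = obj_weight o.
Proof.
move=> [i [m [h [hh [mh ->]]]]]; have [k [j [kh _ kp]]] := is_h_cox_path i.
move: mh; rewrite (is_h_uniq hh kh); case: m => [_|m mk].
  by exists (inl i); rewrite /= ?mul1mx //; apply: fl.
exists (inr (iter m (mulmx cr) (injroot l i))); last by rewrite mxpow_omega.
split=> //; split; last exact: kp.
by apply: iter_rword_root; case: (inj_posroot ul (fl i)).
Qed.

(** The backward orbit of [x] loses positivity right after some [injroot l i], so [x] lies on the
    forward orbit of [omega i]. *)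
Lemma obj_inPi o : is_obj l o -> inPi c w0 (obj_weight o).
Proof.
case: o => [i _|x [xp lx]] /=.
  by have [k [j [kh _ _]]] := is_h_cox_path i; exists i, 0%N, k.+1; rewrite mul1mx.
have ex := cox_orbit_neg ol xp lx (or_intror erefl).
case: (ex_minnP ex) => [[|m] mneg mmin]; first by case: xp mneg => _ /= ->.
set y := iter m (mulmx (rword (rev l))) x.
have yr : is_root y by apply: iter_rword_root; case: xp.
have yp : nonneg y by apply: contraT => /mmin; rewrite ltnn.
have back (a b : nat) : iter a (mulmx cr) (iter (a + b) (mulmx (rword (rev l))) x) =
    iter b (mulmx (rword (rev l))) x.
  by elim: a b => // a ih b; rewrite iterSr addSn iterS /cr rwordVK ih.
have [||i _ iE] := @cox_negP l (- (rword (rev l) *m y)) ul.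
- by apply: negrootP; [exact: rword_root | exact: mneg].
- by rewrite mulmxN rwordVK posrootN.
have yE : y = injroot l i by apply/oppr_inj; rewrite -cox_proj ?fl // -iE mulmxN rwordVK.
have [k [j [kh kE kp]]] := is_h_cox_path i.
(* Otherwise the negative vector following [projroot l j] would be a backward iterate of [x] of
   index below [m.+1]. *)
have mk : (m <= k)%N.
  rewrite leqNgt; apply/negP => km; have := proj_cox ul (fl j); rewrite -kE -iterS -yE /y.
  rewrite -(subnKC km) back => /mmin.
  by rewrite leqNgt ltnS leq_subr.
exists i, m.+1, k.+1; split=> //; split=> //; rewrite mxpow_omega -yE /y.
by have := back m 0%N; rewrite addn0 /= => ->.
Qed.

(** * The compatibility degree and clusters of weights *)

Variable f : 'cV[int]_n -> 'cV[int]_n -> int.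
Hypothesis f_compat : is_compat_degree A c w0 f.

(** Both sides are invariant under [tau], so [o] may be moved to some [inl i]. There the degree is
    the positive part of coordinate [i] of [almost_root o']. *)
Lemma compat_degreeE o o' : is_obj l o -> is_obj l o' ->
  (f (obj_weight o) (obj_weight o') == 0) = compat o o'.
Proof.
move=> ho ho'; have [k [i]] := obj_tau_reaches_inl ol ho.
have [f_tau f_init] := f_compat.
elim: k o o' ho ho' => [|k ih] o o' ho ho'; last first.
  rewrite iterSr => /ih h.
  rewrite -f_tau ?tau_obj_weight ?h ?obj_tau_compat //; try exact: obj_inPi; exact: obj_tau_obj.
move=> /= oE; rewrite oE /=.
rewrite (f_init i _ (fun j => almost_root o' j 0)); first last.
- by rewrite cox_invE alpha_sum.
- exact: obj_inPi.
case: o' ho' => [j _|x [[_ /nonnegP xp] _]] /=; last by rewrite max_l.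
by rewrite mxE max_r // oppr_le0; have [_ /nonnegP] := proj_posroot ul (fl j).
Qed.

Lemma cluster_objs (s : seq 'cV[int]_n) : is_cluster c w0 f s ->
  exists2 t, is_obj_cluster l t & s = map obj_weight t.
Proof.
move=> [us [[sPi sf] smax]].
have [t tobj sE] : exists2 t, {in t, forall o, is_obj l o} & s = map obj_weight t.
  elim: s sPi {us sf smax} => [|lam s ih] sPi; first by exists [::].
  have [|t tobj ->] := ih; first by move=> mu ms; apply: sPi; rewrite inE ms orbT.
  have [o ho ->] := inPi_obj (sPi lam (mem_head _ _)).
  by exists (o :: t) => // o'; rewrite inE => /orP[/eqP ->|/tobj].
(* [compat_set] constrains distinct weights only; equal pairs are compatible because [euler x x] is
   positive. *)
exists t => //; subst s; have compat_diag o : is_obj l o -> compat o o.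
  by case: o => //= x [[[/ltW ->]]].
split=> // [|o o' ot ot'|o ho hc].
- exact: map_uniq us.
- have [<-|noo'] := eqVneq o o'; first exact/compat_diag/tobj.
  rewrite -(compat_degreeE (tobj _ ot) (tobj _ ot')) sf ?map_f //.
  by apply: contra_neq noo'; apply: obj_weight_inj; exact: tobj.
have : obj_weight o \in map obj_weight t.
  apply: (smax (obj_weight o :: map obj_weight t)).
  - have fh o1 o2 : is_obj l o1 -> is_obj l o2 -> compat o1 o2 ->
      f (obj_weight o1) (obj_weight o2) = 0.
      by move=> h1 h2; rewrite -compat_degreeE // => /eqP.
    split=> [lam|lam mu]; rewrite !inE.
      by move=> /orP[/eqP ->|/sPi //]; apply: obj_inPi.
    move=> /orP[/eqP ->|/mapP[o1 ot1 ->]] /orP[/eqP ->|/mapP[o2 ot2 ->]] ne.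
    + by rewrite eqxx in ne.
    + by apply: fh => //; [exact: tobj | exact: hc].
    + by apply: fh => //; [exact: tobj | rewrite compatC; exact: hc].
    + by apply: sf => //; apply: map_f.
  - by move=> lam lt; rewrite inE lt orbT.
  - exact: mem_head.
by move=> /mapP[o' ot' /(obj_weight_inj ho (tobj _ ot')) ->].
Qed.

(** [weightmx] is triangular with diagonal [-1], so some [yv], zero wherever [inl j \in t], has a
    weight agreeing with [v] at all other [j]. The roots of [t] generate [yv], and the remaining
    difference is a combination of the [omega i] in the cluster. *)
Lemma cluster_spans (s : seq 'cV[int]_n) : is_cluster c w0 f s ->
  size s = size l /\ forall v, exists a : nat -> int, v = \sum_(m < size s) a m *: s`_m.
Proof.
move=> /cluster_objs[t tcl ->]; have [szt span] := obj_cluster_basis ol tcl.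
rewrite size_map; split=> // v; have [ut _ _ _] := tcl.
have [y yE] := @triangular_solve (fun j k => pos k < pos j)%N pos
  (fun j k => if inl j \in t then 0 else A j k)
  (fun j => if inl j \in t then 0 else - v j 0) (fun j k jk => jk).
pose yv : 'cV[int]_n := \col_j y j.
have [||a yva] := span yv; first exact: supp.
  by move=> i it; rewrite mxE yE it big1 ?subrr // => k _; rewrite mul0r.
pose b o := match o with inl i => v i 0 - (weightmx *m yv) i 0 | inr _ => a o end.
(* The default [inr 0] is never reached, as [m] stays below [size t]. *)
exists (fun m => b (nth (inr 0) t m)).
rewrite -(big_mkord xpredT (fun m => b (nth (inr 0) t m) *: (map obj_weight t)`_m)).
have -> : \sum_(0 <= m < size t) b (nth (inr 0) t m) *: (map obj_weight t)`_m =
    \sum_(o <- t) b o *: obj_weight o.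
  rewrite (big_nth (inr 0)) !big_nat; apply: eq_bigr => m /andP[_ mt].
  by rewrite (nth_map (inr 0)).
have -> : \sum_(o <- t) b o *: obj_weight o = weightmx *m yv +
    \sum_(i | inl i \in t) (v i 0 - (weightmx *m yv) i 0) *: omega i.
  rewrite {1}yva mulmx_sumr -sum_inl // -big_split; apply: eq_bigr => -[i|x] _ /=.
    by rewrite scaler0 mulmx0 add0r.
  by rewrite -scalemxAr addr0.
have -> : \sum_(i | inl i \in t) (v i 0 - (weightmx *m yv) i 0) *: omega i =
    \sum_i (v i 0 - (weightmx *m yv) i 0) *: basisv i.
  rewrite big_mkcond; apply: eq_bigr => i _; rewrite omegaE; case: ifP => // it.
  suff -> : (weightmx *m yv) i 0 = v i 0 by rewrite subrr scale0r.
  rewrite mxE (bigD1 i) //= !mxE eqxx yE it mulN1r.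
  rewrite (_ : \sum_(k | k != i) _ = - \sum_(k | (pos k < pos i)%N) A i k * y k); first by ring.
  rewrite -sumrN big_mkcond [RHS]big_mkcond; apply: eq_bigr => k _; rewrite !mxE eq_sym.
  case: eqVneq => [->|_] /=; first by rewrite ltnn.
  by case: ifP; rewrite ?mulNr ?mul0r ?oppr0.
under eq_bigr => i _ do rewrite -sub_coord.
by rewrite -cV_sum_basisv addrC subrK.
Qed.

End FullCoxeter.

End EulerForm.

(** * From generating families to bases, and the theorem *)

Lemma Zbasis_of_span n (s : seq 'cV[int]_n) : uniq s -> size s = n ->
  (forall v, exists a : nat -> int, v = \sum_(k < size s) a k *: s`_k) -> is_Zbasis s.
Proof.
move=> us sz span; split=> //; split=> [v|a a0].
  by have [a ->] := span v; exists a.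
pose S : 'M[int]_n := \matrix_(i, k) (s`_k) i 0.
have S_col (b : 'cV[int]_n) : S *m b = \sum_(k < n) b k 0 *: s`_k.
  apply/colP => i; rewrite summxE mxE; apply: eq_bigr => k _.
  by rewrite !mxE mulrC.
have /fin_all_exists[C CE] : forall j : 'I_n, exists b : 'cV[int]_n, S *m b = delta_mx j 0.
  move=> j; have [b bE] := span (delta_mx j 0); exists (\col_k b k).
  rewrite S_col; under eq_bigr => k _ do rewrite mxE.
  by rewrite bE -(big_mkord xpredT (fun k => b k *: s`_k)) sz big_mkord.
(* Over a commutative ring a right inverse of a square matrix is also a left inverse, so the columns
   of [S] are independent. *)
have SC : S *m (\matrix_(i, j) C j i 0) = 1%:M.
  apply/matrixP => i j; have /colP/(_ i) := CE j; rewrite !mxE eqxx andbT => <-.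
  by apply: eq_bigr => k _; rewrite !mxE.
pose b : 'cV[int]_n := \col_k a (cast_ord (esym sz) k).
have Sb : S *m b = 0.
  rewrite S_col -[RHS]a0 [RHS](reindex (cast_ord (esym sz))) /=; last first.
    by exists (cast_ord sz) => k _; rewrite ?cast_ordK ?cast_ordKV.
  by apply: eq_bigr => k _; rewrite mxE.
have b0 : b = 0 by rewrite -[b]mul1mx -(mulmx1C SC) -mulmxA Sb mulmx0.
move=> k; have /colP/(_ (cast_ord sz k)) := b0.
by rewrite !mxE cast_ordK.
Qed.

Lemma pairwise_index (T : eqType) (l : seq T) : uniq l ->
  pairwise (fun x y => index x l < index y l)%N l.
Proof.
case: l => // x0 l ul; apply/(pairwiseP x0) => i j il jl ij.
by rewrite !index_uniq.
Qed.

Theorem theorem2p1 (n : nat) (A : 'M[int]_n) (sigma : {perm 'I_n})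
    (w0 : 'M[int]_n) (f : 'cV[int]_n -> 'cV[int]_n -> int)
    (s : seq 'cV[int]_n) :
  finite_type_cartan A ->
  is_longest A w0 ->
  is_compat_degree A (coxeter A sigma) w0 f ->
  is_cluster (coxeter A sigma) w0 f s ->
  is_Zbasis s.
Proof.
move=> [A_diag [A_offdiag [dq [dq_gt0 [dq_sym dq_pos]]]]] w0_longest f_compat s_cl.
set l := [seq sigma k | k <- enum 'I_n] in f_compat s_cl.
pose pos i := index i l.
have ul : uniq l by rewrite map_inj_uniq ?enum_uniq //; apply: perm_inj.
have fl i : i \in l by apply/mapP; exists (sigma^-1%g i); rewrite ?mem_enum ?permKV.
have szl : size l = n by rewrite size_map size_enum_ord.
have pos_inj : injective pos by move=> i j; apply: index_inj.
have ol : ordered pos l by exact: pairwise_index.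
(* A common denominator, making the rational symmetrizer integral. *)
pose D : int := \prod_j denq (dq j).
have D_gt0 : 0 < D by apply: prodr_gt0 => j _; apply: denq_gt0.
have /fin_all_exists[d dE] i : exists z : int, z%:~R = dq i * D%:~R.
  exists (numq (dq i) * \prod_(j | j != i) denq (dq j)).
  by rewrite [D](bigD1 i) //= !intrM mulrA numqE.
have d_gt0 i : 0 < d i by rewrite -(ltr0z rat) dE mulr_gt0 ?ltr0z.
have dA_sym i j : d i * A i j = d j * A j i.
  by apply: (@intr_inj rat); rewrite /= !intrM !dE mulrAC dq_sym mulrAC.
(* Over the rationals, twice [euler x x] is [D] times the given positive definite form. *)
have euler_gt0 (x : 'cV[int]_n) : x != 0 -> 0 < euler A d pos x x.
  move=> x0; rewrite -(pmulrn_lgt0 _ (isT : 0 < 2)%N) mulr2n euler_sum_sym //.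
  pose xq : 'cV[rat]_n := map_mx intr x.
  have /dq_pos : xq != 0.
    apply: contra_neq x0 => /colP xq0; apply/colP => i; apply: (@intr_inj rat).
    by have := xq0 i; rewrite !mxE.
  rewrite -mulmxA mxE => form_gt0; rewrite -(ltr0z rat).
  have Dq_gt0 : 0 < D%:~R :> rat by rewrite ltr0z.
  have := mulr_gt0 form_gt0 Dq_gt0.
  rewrite mulr_suml rmorph_sum; congr (is_true (0 < _)); apply: eq_bigr => i _ /=.
  rewrite !mxE !intrM dE rmorph_sum !mulr_sumr mulr_suml; apply: eq_bigr => j _ /=.
  by rewrite !mxE intrM; ring.
(* The length bound concerns matrices on weights; injectivity of [A] carries it to the root
   lattice. *)
have rword_bounded : exists L, forall u, exists u',
    rword A u' = rword A u /\ (size u' <= L)%N.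
  have [L [_ [_ bound]]] := w0_longest; exists L => u; have [u' [u'E szu]] := bound u.
  by exists u'; split=> //; apply: (wordmx_rword_inj A_diag dA_sym pos_inj euler_gt0).
have [sz span] := cluster_spans A_diag A_offdiag d_gt0 dA_sym pos_inj euler_gt0
  rword_bounded ol fl w0_longest f_compat s_cl.
by case: s_cl => us _; apply: Zbasis_of_span => //; rewrite sz.
Qed.
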